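(* Let $X$ be a Banach space with separable dual $X^*$ and let $M=(M(t,A):t\ge 0,A\in\mathcal A)$ be a cylindrical orthogonal martingale-valued measure on $X^*$ with family of intensity measures $(\nu_{x^*}:x^*\in X^* )$. Assume that $M$ has a quadratic variation and that $(\nu_{x^*}:x^*\in X^* )$ satisfies the sequential boundedness property. Then $M$ has a unique quadratic variation $\langle\!\langle M\rangle\!\rangle$. Moreover, for any dense subset $(x_n^* )_{n\ge1}$ of the unit sphere of $X^*$ we have $\langle\!\langle M\rangle\!\rangle=\sup_{n\ge1}\nu_{x_n^*}$ $\mathbb P$-a.e. In particular $\langle\!\langle M\rangle\!\rangle$ is a predictable random measure and $\mathbb P$-a.e. $$\langle\!\langle M\rangle\!\rangle([0,t]\times A)=\sup_{\Pi\in\mathscr R([0,t]\times A)}\ \sum_{C\in\Pi}\ \sup_{n\ge1}\nu_{x_n^*}(\omega)(C),\qquad \forall\,t\ge0,\ A\in\mathcal B(U),$$ where $(x_n^* )_{n\ge1}$ is a dense subset of the unit sphere of $X^*$ and $\mathscr R([0,t]\times A)$ is the family of partitions of $[0,t]\times A$ of the form $\Pi=\{(t_{i-1},t_i]\times A_j:1\le i\le k,\ 1\le j\le m\}$, $k,m\in\mathbb N$, with $0=t_0<t_1<\cdots<t_k=t$ rational (with the possible exception of $t$) and $A_1,\dots,A_m$ forming a partition of $A$.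
   Context: $(\Omega,\mathcal F,\mathbb P)$ is a complete probability space with a filtration $(\mathcal F_t)_{t\ge0}$ satisfying the usual conditions. $U$ is a Hausdorff topological space homeomorphic to a Borel subset of $\mathbb R$ (Lusin) and $\mathcal A$ is a ring of Borel subsets of $U$. For square integrable real martingales $Y,Z$, $\langle Y,Z\rangle$ is the predictable quadratic covariation (the unique predictable finite-variation process null at $0$ such that $YZ-\langle Y,Z\rangle$ is a martingale), and $\langle Y\rangle=\langle Y,Y\rangle$. A set function $N:\Omega\times\mathcal A\to\mathbb R$ is a $\sigma$-finite $L^2$-valued measure if: (1) $\mathbb E|N(A)|^2<\infty$ for all $A\in\mathcal A$; (2) $N(A\cup B)=N(A)+N(B)$ $\mathbb P$-a.e. for disjoint $A,B\in\mathcal A$; (3) there is a sequence $(U_n)$ in $\mathcal B(U)$ with $U_n\uparrow U$, $\mathcal B(U_n)\subseteq\mathcal A$ and $\sup_{A\in\mathcal B(U_n)}\mathbb E|N(A)|^2<\infty$ for each $n$; (4) for each $n$ and each sequence $(A_j)$ in $\mathcal B(U_n)$ decreasing to $\emptyset$, $\mathbb E|N(A_j)|^2\to0$; (5) for each $A\in\mathcal A$, $N(A)$ is the $L^2$-limit of $N(A\cap U_n)$. A cylindrical random variable on $X$ is a continuous linear map $X^*\to L^0(\Omega,\mathcal F,\mathbb P)$ (with convergence in probability). A cylindrical orthogonal martingale-valued measure on $X^*$ is a collection $M=(M(t,A):t\ge0,A\in\mathcal A)$ of cylindrical random variables on $X$ such that: (i) $M(0,A)(x^* )=0$ $\mathbb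 P$-a.e. for all $A,x^*$; (ii) for each $A$ and $x^*$, $M(A)(x^* )=(M(t,A)(x^* ))_{t\ge0}$ is a real càdlàg mean-zero square integrable martingale, and each $M(t,A):X^*\to L^0$ is continuous; (iii) for $t>0$ and $x^*\in X^*$, $M(t,\cdot)(x^* )$ is a $\sigma$-finite $L^2$-valued measure; (iv) $\langle M(A)(x^* ),M(B)(x^* )\rangle_t=0$ for $t>0$, $x^*\in X^*$ and disjoint $A,B\in\mathcal A$. A random measure on a measurable space $(S,\Sigma)$ is a map $\mu:\Omega\times\Sigma\to[0,\infty]$ such that $\mu(\cdot,E)$ is measurable for every $E\in\Sigma$ and $\mu(\omega,\cdot)$ is a measure for a.e. $\omega$. Such a random measure on $\mathcal B(\mathbb R_+)\otimes\mathcal B(U)$ is predictable if $(\omega,t)\mapsto\mu(\omega)([0,t]\times B)$ is predictable for each $B\in\mathcal B(U)$. The intensity measure $\nu_{x^*}$ is the unique predictable $\sigma$-finite random measure on $\mathcal B(\mathbb R_+)\otimes\mathcal B(U)$ with $\nu_{x^*}([0,t]\times A)=\langle M(A)(x^* )\rangle_t$ $\mathbb P$-a.e. for every $t\ge0$, $A\in\mathcal A$. For measures, $\nu\le\mu$ means $\nu(C)\le\mu(C)$ for all measurable $C$; for random measures, $\eta\le\zeta$ means $\eta(\omega)\le\zeta(\omega)$ for $\mathbb P$-a.e. $\omega$. The supremum $\sup_\alpha\mu_\alpha$ of a family of measures is the smallest measure dominating all $\mu_\alpha$; explicitly $(\sup_\alpha\mu_\alpha)(A)=\sup_{\Pi}\sum_{C\in\Pi}\sup_\alpha\mu_\alpha(C)$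 over finite measurable partitions $\Pi$ of $A$. For random measures it is taken for each $\omega$. $M$ has a quadratic variation $\eta$ if $\eta$ is a random measure on $\mathcal B(\mathbb R_+)\otimes\mathcal B(U)$ such that: (a) for every $t\ge0$, $A\in\mathcal A$, $\eta([0,t]\times A)<\infty$ $\mathbb P$-a.e.; (b) $\eta$ is a minimal element (for $\le$) of the collection of all random measures $\zeta$ with $\nu_{x^*}\le\zeta$ for every $x^*\in X^*$ with $\|x^*\|=1$. If the quadratic variation is unique it is denoted $\langle\!\langle M\rangle\!\rangle$. The family $(\nu_{x^*})$ satisfies the sequential boundedness property if whenever $(x_n^* )$ is dense in the unit sphere of $X^*$, $\|x^*\|=1$ and $t>0$, there is $\Omega_{x^*}\subseteq\Omega$ with $\mathbb P(\Omega_{x^*})=1$ such that for all $0\le s<t$, $A\in\mathcal A$, $\omega\in\Omega_{x^*}$: $\nu_{x^*}(\omega)((s,t]\times A)\le\sup_{n\ge1}\nu_{x_n^*}(\omega)((s,t]\times A)$ (supremum of numbers in $[0,\infty]$). *)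

(* Defs.v *)
From HB Require Import structures.
From mathcomp Require Import all_boot all_order all_algebra.
From mathcomp Require Import all_classical all_reals all_analysis.
From mathcomp Require Import measurable_realfun.
Import numFieldNormedType.Exports.
Import Order.TTheory GRing.Theory Num.Theory.

Set Implicit Arguments.
Unset Strict Implicit.
Unset Printing Implicit Defensive.

Local Open Scope classical_set_scope.
Local Open Scope ring_scope.

(* The topological dual X^*, as a normed space under the operator norm. *)
Section dual.
Context (R : realType) (X : normedModType R).

Definition dual_pred : {pred X -> R^o} :=
  [pred f : X -> R^o |
    `[< (forall a x y, f (a *: x + y) = a * f x + f y) /\ continuous f >]].

Fact dual_submod_closed : GRing.submod_closed dual_pred.
Proof.
split; first (apply/asboolP; split => [a x y|]).
- by rewrite mulr0 addr0.
- exact: cst_continuous.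
move=> a f g /asboolP[lf cf] /asboolP[lg cg].
apply/asboolP; split => [b x y|x].
  rewrite !fctE lf lg /GRing.scale/= !mulrDr !mulrA (mulrC a b) addrACA.
  by rewrite -!mulrA.
by apply: cvgD; [apply: cvgZr; exact: cf | exact: cg].
Qed.

HB.instance Definition _ :=
  GRing.isSubmodClosed.Build R (X -> R^o) dual_pred dual_submod_closed.

Record dual := Dual { dual_fun :> X -> R^o ; _ : dual_fun \in dual_pred }.

HB.instance Definition _ := [isSub for dual_fun].
HB.instance Definition _ := gen_eqMixin dual.
HB.instance Definition _ := gen_choiceMixin dual.
HB.instance Definition _ := [SubChoice_isSubLmodule of dual by <:].

Definition dual_norm (f : dual) : R := sup [set `|f x| | x in [set x | `|x| <= 1]].

Lemma dual_linear (f : dual) a x y : f (a *: x + y) = a * f x + f y.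
Proof. by case: f => f /= /asboolP[]. Qed.

Lemma dual_continuous (f : dual) : continuous f.
Proof. by case: f => f /= /asboolP[]. Qed.

Lemma dual0 (f : dual) : f 0 = 0.
Proof. by have := dual_linear f (-1) 0 0; rewrite scaler0 addr0 mulN1r addNr. Qed.

Lemma dualZ (f : dual) a x : f (a *: x) = a * f x.
Proof. by have := dual_linear f a x 0; rewrite dual0 !addr0. Qed.

Lemma dual_bounded (f : dual) : exists M, forall x, `|x| <= 1 -> `|f x| <= M.
Proof.
have lf : linear (f : X -> R^o) by move=> a x y; exact: dual_linear.
pose L := GRing.isLinear.Build R X R^o *:%R f lf.
pose g : {linear X -> R^o} := HB.pack (f : X -> R^o) L.
have /linear_bounded_continuous/bounded_funP/(_ 1) : continuous g.
  exact: dual_continuous.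
exact.
Qed.

Lemma dual_norm_has_sup (f : dual) :
  has_sup [set `|f x| | x in [set x | `|x| <= 1]].
Proof.
split; first by exists `|f 0|, 0 => //=; rewrite normr0.
by have [M fM] := dual_bounded f; exists M => _ [x x1 <-]; exact: fM.
Qed.

Lemma dual_norm_ub (f : dual) x : `|x| <= 1 -> `|f x| <= dual_norm f.
Proof. by move=> x1; apply: (sup_upper_bound (dual_norm_has_sup f)); exists x. Qed.

Lemma dual_norm_le (f : dual) M :
  (forall x, `|x| <= 1 -> `|f x| <= M) -> dual_norm f <= M.
Proof.
move=> fM; apply: ge_sup; first by case: (dual_norm_has_sup f).
by move=> _ [x x1 <-]; exact: fM.
Qed.

Fact ler_dual_normD (f g : dual) :
  dual_norm (f + g) <= dual_norm f + dual_norm g.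
Proof.
apply: dual_norm_le => x x1; rewrite (le_trans (ler_normD _ _))//.
by rewrite lerD// dual_norm_ub.
Qed.

Let dual_normZ_le a (f : dual) : dual_norm (a *: f) <= `|a| * dual_norm f.
Proof.
apply: dual_norm_le => x x1.
by rewrite [_ x]/(a * f x) normrM ler_wpM2l// dual_norm_ub.
Qed.

Fact dual_normZ a (f : dual) : dual_norm (a *: f) = `|a| * dual_norm f.
Proof.
apply/eqP; rewrite eq_le dual_normZ_le/=.
have [->|a0] := eqVneq a 0.
  rewrite normr0 mul0r (le_trans (normr_ge0 ((0 *: f) 0)))//.
  by rewrite dual_norm_ub// normr0.
rewrite -ler_pdivlMl ?normr_gt0// -normfV.
by have := dual_normZ_le a^-1 (a *: f); rewrite scalerA mulVf// scale1r.
Qed.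

Fact dual_norm0_eq0 (f : dual) : dual_norm f = 0 -> f = 0.
Proof.
move=> f0; apply: val_inj; apply/funext => x /=.
have [->|x0] := eqVneq x 0; first by rewrite dual0.
have nx0 : `|x| != 0 by rewrite normr_eq0.
have : `|f (`|x|^-1 *: x)| <= dual_norm f.
  by apply: dual_norm_ub; rewrite normrZ normfV normr_id mulVf.
rewrite f0 normr_le0 dualZ mulf_eq0 invr_eq0 (negbTE nx0)/=.
by move=> /eqP.
Qed.

HB.instance Definition _ := Lmodule_isNormed.Build R dual
  ler_dual_normD dual_normZ dual_norm0_eq0.

End dual.

Definition separable (E : topologicalType) :=
  exists2 D : set E, countable D & dense D.

Definition dense_in_sphere (R : realType) (V : normedModType R) (x : nat -> V) :=
  (forall n, `|x n| = 1) /\ [set y | `|y| = 1] `<=` closure (range x).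

(* The half-line [0, +oo[ and its Borel sigma-algebra (the trace of that of R). *)
Definition halfline (R : realType) : Type := {x : R | 0 <= x}.
HB.instance Definition _ (R : realType) := SubChoice.on (halfline R).
HB.instance Definition _ (R : realType) :=
  isPointed.Build (halfline R) (exist _ 0 (lexx 0)).
Definition Rplus (R : realType) :=
  g_sigma_algebra_preimageType (fun t : halfline R => sval t).
HB.instance Definition _ (R : realType) := Measurable.on (Rplus R).

Definition borel (E : ptopologicalType) := g_sigma_algebraType (@open E).
HB.instance Definition _ (E : ptopologicalType) := Measurable.on (borel E).

Definition borel_set (E : ptopologicalType) : set (set E) :=
  @measurable _ (borel E).

Definition homeomorphic_to_borel_of_R (R : realType) (E : topologicalType) :=
  exists (f : E -> R) (g : R -> E),
    [/\ measurable (range f), continuous f, cancel f g &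
        {within range f, continuous g}].

(* Processes are indexed by R; only times t >= 0 are ever considered. *)
Section processes.
Context (R : realType) (d : measure_display) (T : measurableType d).
Variables (P : probability T R) (F : R -> set (set T)).

Definition usual_filtration :=
  [/\ forall t, 0 <= t -> sigma_algebra setT (F t) /\ F t `<=` measurable,
      forall s t, 0 <= s -> s <= t -> F s `<=` F t,
      forall t, 0 <= t -> F t = \bigcap_(s in [set s | t < s]) F s &
      P.-negligible `<=` F 0].

Definition sub_measurable (G : set (set T)) (Y : T -> R) :=
  forall B : set R, measurable B -> G (Y @^-1` B).

(* Y is a version of the conditional expectation E[Z | G]. *)
Definition is_cond_exp (G : set (set T)) (Z Y : T -> R) :=
  [/\ sub_measurable G Y, P.-integrable setT (EFin \o Y) &
      forall A, G A ->
        (\int[P]_(w in A) (Y w)%:E = \int[P]_(w in A) (Z w)%:E)%E].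

Definition martingale (Y : R -> T -> R) :=
  [/\ forall t, 0 <= t -> sub_measurable (F t) (Y t),
      forall t, 0 <= t -> P.-integrable setT (EFin \o Y t) &
      forall s t, 0 <= s -> s <= t -> is_cond_exp (F s) (Y t) (Y s)].

Definition cadlag (f : R -> R) :=
  (forall t, 0 <= t -> f s @[s --> t^'+] --> f t) /\
  (forall t, 0 < t -> cvg (f s @[s --> t^'-])).

Definition square_integrable (Y : R -> T -> R) :=
  forall t, 0 <= t -> ('E_P[fun w => (Y t w ^+ 2)%R] < +oo)%E.

Definition predictable_rect : set (set (T * Rplus R)) :=
  [set C | (exists2 A, F 0 A & C = A `*` [set r | sval r = 0]) \/
           (exists s t A, [/\ 0 <= s, s < t, F s A &
                              C = A `*` [set r | s < sval r <= t]])].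

Definition predictable (d' : measure_display) (E : measurableType d')
    (Y : T * Rplus R -> E) :=
  measurable_fun setT (Y : g_sigma_algebraType predictable_rect -> E).

(* V is a version of the predictable quadratic covariation <Y, Z>; as usual,
   "finite variation process" includes cadlag paths. *)
Definition is_covariation (Y Z V : R -> T -> R) :=
  [/\ predictable (fun p => V (sval p.2) p.1),
      {ae P, forall w, V 0 w = 0},
      {ae P, forall w, cadlag (V ^~ w) /\
                       forall t, 0 <= t -> bounded_variation 0 t (V ^~ w)} &
      martingale (fun t w => Y t w * Z t w - V t w)].

End processes.

Section martingale_valued_measures.
Context (R : realType) (d : measure_display) (T : measurableType d).
Context (U : ptopologicalType) (X : normedModType R).
Variables (P : probability T R) (F : R -> set (set T)) (calA : set (set U)).

Definition sigma_finite_L2_measure (N : set U -> T -> R) :=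
  [/\ forall A, calA A ->
        measurable_fun setT (N A) /\ ('E_P[fun w => (N A w ^+ 2)%R] < +oo)%E,
      forall A B, calA A -> calA B -> A `&` B = set0 ->
        {ae P, forall w, N (A `|` B) w = N A w + N B w} &
      exists Un : nat -> set U,
      [/\ [/\ forall n, borel_set (Un n), nondecreasing_seq Un &
              \bigcup_n Un n = setT],
          forall n A, borel_set A -> A `<=` Un n -> calA A,
          forall n, (ereal_sup [set 'E_P[fun w => (N A w ^+ 2)%R] |
                       A in [set A | borel_set A /\ A `<=` Un n]] < +oo)%E,
          forall n (Aj : nat -> set U),
            (forall j, borel_set (Aj j) /\ Aj j `<=` Un n) ->
            nonincreasing_seq Aj -> \bigcap_j Aj j = set0 ->
            ('E_P[fun w => (N (Aj j) w ^+ 2)%R])%E @[j --> \oo] --> 0%E &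
          forall A, calA A ->
            ('E_P[fun w => ((N A w - N (A `&` Un n) w) ^+ 2)%R])%E @[n --> \oo]
              --> 0%E]].

(* A cylindrical random variable, given by a representative of each class of
   L^0; convergence in L^0 is convergence in probability. *)
Definition cylindrical_rv (C : dual X -> T -> R) :=
  [/\ forall x, measurable_fun setT (C x),
      forall a x y, {ae P, forall w, C (a *: x + y) w = a * C x w + C y w} &
      forall x (e : R), 0 < e ->
        P [set w | e <= `|C y w - C x w|] @[y --> x] --> 0%E].

(* For each A and x the process M(., A)(x) is given by a version with almost
   surely cadlag paths. *)
Definition orthogonal_mvm (M : R -> set U -> dual X -> T -> R) :=
  [/\ forall t A, 0 <= t -> calA A -> cylindrical_rv (M t A),
      forall A x, calA A -> {ae P, forall w, M 0 A x w = 0},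
      forall A x, calA A ->
        [/\ {ae P, forall w, cadlag (fun t => M t A x w)},
            martingale P F (fun t => M t A x),
            square_integrable P (fun t => M t A x) &
            forall t, 0 <= t -> ('E_P[M t A x] = 0)%E],
      forall t x, 0 < t -> sigma_finite_L2_measure (fun A => M t A x) &
      forall A B x, calA A -> calA B -> A `&` B = set0 ->
        exists2 V, is_covariation P F (fun t => M t A x) (fun t => M t B x) V &
          forall t, 0 < t -> {ae P, forall w, V t w = 0}].

Definition spacetime : Type := (Rplus R * borel U)%type.
HB.instance Definition _ := Measurable.on spacetime.

Definition strip0 (t : R) (A : set U) : set spacetime :=
  [set p | sval p.1 <= t /\ A p.2].

Definition strip (s t : R) (A : set U) : set spacetime :=
  [set p | s < sval p.1 <= t /\ A p.2].

Definition is_measure (mu : set spacetime -> \bar R) :=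
  [/\ mu set0 = 0%E, forall C, measurable C -> (0 <= mu C)%E &
      semi_sigma_additive mu].

Definition random_measure (mu : T -> set spacetime -> \bar R) :=
  [/\ forall w C, measurable C -> (0 <= mu w C)%E,
      forall C, measurable C -> measurable_fun setT (mu ^~ C) &
      {ae P, forall w, is_measure (mu w)}].

Definition predictable_measure (mu : T -> set spacetime -> \bar R) :=
  forall B, borel_set B -> predictable F (fun p => mu p.1 (strip0 (sval p.2) B)).

Definition rm_le (eta zeta : T -> set spacetime -> \bar R) :=
  {ae P, forall w, forall C, measurable C -> (eta w C <= zeta w C)%E}.

Definition rm_eq (eta zeta : T -> set spacetime -> \bar R) :=
  {ae P, forall w, forall C, measurable C -> eta w C = zeta w C}.

Definition is_intensity (M : R -> set U -> dual X -> T -> R) (x : dual X)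
    (nu : T -> set spacetime -> \bar R) :=
  [/\ random_measure nu, predictable_measure nu,
      {ae P, forall w, sigma_finite setT (nu w)} &
      forall A, calA A ->
        exists2 V, is_covariation P F (fun t => M t A x) (fun t => M t A x) V &
          forall t, 0 <= t -> {ae P, forall w, nu w (strip0 t A) = (V t w)%:E}].

Definition finite_partition (E : set spacetime) (Pi : seq (set spacetime)) :=
  [/\ forall i, (i < size Pi)%N -> measurable (nth set0 Pi i),
      trivIset `I_(size Pi) (nth set0 Pi) &
      \bigcup_(i in `I_(size Pi)) nth set0 Pi i = E].

Definition measure_sup (mu : nat -> set spacetime -> \bar R)
    (E : set spacetime) : \bar R :=
  ereal_sup [set (\sum_(C <- Pi) ereal_sup (range (fun n => mu n C)))%E |
             Pi in finite_partition E].

(* k = 0 is allowed and is the only possibility when t = 0. *)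
Definition grid_partition (t : R) (A : set U) (Pi : seq (set spacetime)) :=
  exists (k m : nat) (tau : nat -> R) (Aj : nat -> set U),
  [/\ [/\ tau 0%N = 0, tau k = t,
          forall i, (i < k)%N -> tau i < tau i.+1 &
          forall i, (i < k)%N -> exists q : rat, tau i = ratr q],
      [/\ forall j, (j < m)%N -> borel_set (Aj j), trivIset `I_m Aj &
          \bigcup_(j in `I_m) Aj j = A] &
      Pi = [seq strip (tau i) (tau i.+1) (Aj j) | i <- iota 0 k, j <- iota 0 m]].

Definition dominates_intensities (nu : dual X -> T -> set spacetime -> \bar R)
    (zeta : T -> set spacetime -> \bar R) :=
  random_measure zeta /\ forall x, `|x| = 1 -> rm_le (nu x) zeta.

(* nu is the family of intensity measures of the martingale-valued measure. *)
Definition quadratic_variation (nu : dual X -> T -> set spacetime -> \bar R)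
    (eta : T -> set spacetime -> \bar R) :=
  [/\ forall t A, 0 <= t -> calA A ->
        {ae P, forall w, (eta w (strip0 t A) < +oo)%E},
      dominates_intensities nu eta &
      forall zeta, dominates_intensities nu zeta ->
        rm_le zeta eta -> rm_le eta zeta].

Definition sequential_boundedness
    (nu : dual X -> T -> set spacetime -> \bar R) :=
  forall (xn : nat -> dual X) (x : dual X) (t : R),
    dense_in_sphere xn -> `|x| = 1 -> 0 < t ->
    exists W : set T, [/\ measurable W, P W = 1%E &
      forall s A w, 0 <= s -> s < t -> calA A -> W w ->
        (nu x w (strip s t A) <=
         ereal_sup (range (fun n => nu (xn n) w (strip s t A))))%E].

End martingale_valued_measures.

(* Main.v *)
Require Import Defs.
From HB Require Import structures.
From mathcomp Require Import all_boot all_order all_algebra.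
From mathcomp Require Import all_classical all_reals all_analysis.
From mathcomp Require Import measurable_realfun.
Import numFieldNormedType.Exports.
Import Order.TTheory GRing.Theory Num.Theory.

Set Implicit Arguments.
Unset Strict Implicit.
Unset Printing Implicit Defensive.

Local Open Scope classical_set_scope.
Local Open Scope ring_scope.

(** Fix a dense sequence x_n of the unit sphere and let s be the pointwise
    supremum of the outer measures induced by the nu_{x_n}. Cut spacetime by
    countably many generating sets [time <= q] and [f <= q], where f embeds U
    into R. For a finite list of cuts, the associated cut sum of E adds up s over
    the cells into which the cuts divide E; these sums increase with the list.
    Their supremum over all lists is an outer measure for which every cut is
    Caratheodory measurable, hence a measure: it is the least measure above all
    nu_{x_n}. Being a countable supremum, it is measurable (and predictable) in
    the randomness, and on strips every cut sum is dominated by a rational grid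
    sum. By sequential boundedness it dominates every nu_x on rational strips,
    hence everywhere, by comparing nu_x with the measure generated in the same
    way by the maximum of the two. It is therefore the least dominating random
    measure, and finite because the given quadratic variation lies above it. *)

(** * Measures generated by cut sums *)

Section cut_sums.
Local Open Scope ereal_scope.
Context {R : realType}.

(** Take the supremum over [b] for fixed [a], then over [a]. A term can be moved across the
    inequality only if it is finite; a term [+oo] forces [c = +oo], and an empty [B] makes the sum
    [-oo]. *)
Lemma ge_ereal_supD (A B : set (\bar R)) (c : \bar R) :
  A !=set0 -> (forall a, A a -> 0 <= a) -> (forall b, B b -> 0 <= b) ->
  (forall a b, A a -> B b -> a + b <= c) -> ereal_sup A + ereal_sup B <= c.
Proof.
move=> [a0 Aa0] A0 B0 ABc.
have sA0 : 0 <= ereal_sup A by apply: le_ereal_sup_tmp; exists a0; rewrite ?A0.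
have aBc a : A a -> a + ereal_sup B <= c.
  move=> Aa; have := A0 _ Aa; have := fun b => ABc a b Aa.
  case: a {Aa} => // [a|] ac a0'; last first.
    have [->|/set0P[b Bb]] := eqVneq B set0; first by rewrite ereal_sup0 addeNy leNye.
    have := ac b Bb; rewrite addye; last by rewrite gt_eqF// (lt_le_trans _ (B0 _ Bb)).
    by rewrite leye_eq => /eqP ->; rewrite leey.
  rewrite -leeBrDl//; apply: ge_ereal_sup => b Bb.
  by rewrite leeBrDl// ac.
have [Bfin|] := boolP (ereal_sup B \is a fin_num).
  by rewrite -leeBrDr//; apply: ge_ereal_sup => a Aa; rewrite leeBrDr// aBc.
rewrite fin_numE negb_and !negbK => /orP[/eqP ->|/eqP sB].
  by rewrite addeNy leNye.
have := aBc _ Aa0; rewrite sB addey; last by rewrite gt_eqF// (lt_le_trans _ (A0 _ Aa0)).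
by rewrite leye_eq => /eqP ->; rewrite leey.
Qed.

Context {T : Type}.
Implicit Types (s : set T -> \bar R) (E : set T).

(** A property of the bare function, so that it can be carried through inductions on lists of cuts;
    rewriting along the equation gives access to the theory of outer measures. *)
Definition is_outer_measure s :=
  exists m : {outer_measure set T -> \bar R}, m = s :> (set T -> \bar R).

Lemma is_outer_measureP s : s set0 = 0 -> (forall E, 0 <= s E) ->
  {homo s : A B / A `<=` B >-> A <= B} -> sigma_subadditive s ->
  is_outer_measure s.
Proof.
move=> s0 s_ge0 s_homo s_sub.
pose b := isOuterMeasure.Build R T s s0 s_ge0 s_homo s_sub.
by pose m : {outer_measure set T -> \bar R} := HB.pack s b; exists m.
Qed.

Lemma is_outer_measure_sup (J : pointedType) (f : J -> set T -> \bar R) :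
  (forall j, is_outer_measure (f j)) ->
  is_outer_measure (fun E => ereal_sup (range (f ^~ E))).
Proof.
move=> of_; have sup_ge j E : f j E <= ereal_sup (range (f ^~ E)).
  by apply: ereal_sup_ubound; exists j.
apply: is_outer_measureP.
- apply/eqP; rewrite eq_le; apply/andP; split.
    by apply: ge_ereal_sup => _ [j _ <-]; have [m <-] := of_ j; rewrite outer_measure0.
  apply: (le_trans _ (sup_ge point _)).
    by have [m <-] := of_ point; exact: outer_measure_ge0.
- move=> E; apply: (le_trans _ (sup_ge point _)).
  by have [m <-] := of_ point; exact: outer_measure_ge0.
- move=> A B AB; apply: ge_ereal_sup => _ [j _ <-].
  apply: (le_trans _ (sup_ge j B)).
  by have [m <-] := of_ j; exact: le_outer_measure.
- move=> F; apply: ge_ereal_sup => _ [j _ <-].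
  have [m fm] := of_ j.
  rewrite -{1}fm (le_trans (outer_measure_sigma_subadditive _ _))//.
  apply: lee_nneseries => [k _ _|k _]; first exact: outer_measure_ge0.
  by rewrite fm.
Qed.

Context {I : Type} (D : I -> set T).

Fixpoint cut_sum s (l : seq I) E : \bar R :=
  if l is i :: l' then cut_sum s l' (E `&` D i) + cut_sum s l' (E `&` ~` D i)
  else s E.

Definition cut_sup s E := ereal_sup (range (fun l => cut_sum s l E)).

Lemma is_outer_measure_cut_sum s l :
  is_outer_measure s -> is_outer_measure (cut_sum s l).
Proof.
move=> os; elim: l => [|i l [m ml]] //=; rewrite -ml.
apply: is_outer_measureP => [|E|A B AB|F].
- by rewrite !set0I !outer_measure0 adde0.
- by rewrite adde_ge0 ?outer_measure_ge0.
- by apply: leeD; apply: le_outer_measure; exact: setSI.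
- rewrite nneseriesD => [|k _ _|k _ _]; try exact: outer_measure_ge0.
  by apply: leeD; rewrite setI_bigcupl; exact: outer_measure_sigma_subadditive.
Qed.

Lemma cut_sum_ge0 s l E : is_outer_measure s -> 0 <= cut_sum s l E.
Proof.
by move=> /(is_outer_measure_cut_sum l)[m <-]; exact: outer_measure_ge0.
Qed.

Lemma cut_sum_eq0 s l E : is_outer_measure s -> s E = 0 -> cut_sum s l E = 0.
Proof.
move=> [m <-]; elim: l E => [//|i l ih] E mE /=.
have null A : m (E `&` A) = 0.
  by apply/eqP; rewrite eq_le outer_measure_ge0 -{1}mE le_outer_measure.
by rewrite !ih ?adde0.
Qed.

(** A cut placed in front splits [E] first, and [cut_sum s l] is itself an outer measure, so
    subadditivity applies at each such cut. *)
Lemma le_cut_sum_catl s l l' E : is_outer_measure s ->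
  cut_sum s l E <= cut_sum s (l' ++ l) E.
Proof.
move=> os; elim: l' E => [|i l' ih] E //=.
apply: (@le_trans _ _ (cut_sum s l (E `&` D i) + cut_sum s l (E `&` ~` D i))).
  by have [m <-] := is_outer_measure_cut_sum l os; exact: le_outer_measureIC.
exact: leeD.
Qed.

(** Appended cuts only subdivide the cells left by [l], and on each cell the case of the empty list
    applies. *)
Lemma le_cut_sum_catr s l l' E : is_outer_measure s ->
  cut_sum s l E <= cut_sum s (l ++ l') E.
Proof.
move=> os; elim: l E => [|i l ih] E /=; last exact: leeD.
by have := le_cut_sum_catl [::] l' E os; rewrite cats0.
Qed.

Lemma le_cut_sup s l E : cut_sum s l E <= cut_sup s E.
Proof. by apply: ereal_sup_ubound; exists l. Qed.

Lemma is_outer_measure_cut_sup s : is_outer_measure s ->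
  is_outer_measure (cut_sup s).
Proof.
move=> os.
pose J : pointedType := HB.pack (seq I) (isPointed.Build (seq I) [::])
  (gen_eqMixin (seq I)) (gen_choiceMixin (seq I)).
apply: (@is_outer_measure_sup J) => l.
exact: is_outer_measure_cut_sum.
Qed.

(* A cut is a Caratheodory set because a cut sum over [l] on [D i] and one over
   [l'] on its complement are both bounded by a single cut sum over
   [i :: l ++ l']. *)
Lemma cut_sup_caratheodory s i : is_outer_measure s ->
  (cut_sup s).-caratheodory (D i).
Proof.
move=> os; have [m ms] := is_outer_measure_cut_sup os.
rewrite -ms; apply: le_caratheodory_measurable => E; rewrite ms.
apply: ge_ereal_supD.
- by exists (cut_sum s [::] (E `&` D i)), [::].
- by move=> _ [l _ <-]; exact: cut_sum_ge0.
- by move=> _ [l _ <-]; exact: cut_sum_ge0.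
move=> _ _ [l _ <-] [l' _ <-]; apply: (le_trans _ (le_cut_sup _ (i :: l ++ l') _)).
by rewrite /= leeD ?le_cut_sum_catl ?le_cut_sum_catr.
Qed.

Lemma cut_sup_eq0 s E : is_outer_measure s -> s E = 0 -> cut_sup s E = 0.
Proof.
move=> os sE; rewrite -(ereal_sup1 0); congr ereal_sup.
apply/seteqP; split => [_ [l _ <-]|_ ->] /=; first exact: cut_sum_eq0.
by exists [::].
Qed.

End cut_sums.

(** * Monotonicity of cut sums in the set of cuts *)

Section cut_sum_subset.
Local Open Scope ereal_scope.
Context {R : realType} {T : Type} {I : eqType} (D : I -> set T).
Implicit Types (s : set T -> \bar R) (l : seq I) (E : set T).

(** Each cell of [l] already lies on one side of [D i], so the extra split only adds empty cells, of
    value 0. *)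
Lemma cut_sum_mem s l i E : is_outer_measure s -> i \in l ->
  cut_sum D s l E = cut_sum D s l (E `&` D i) + cut_sum D s l (E `&` ~` D i).
Proof.
move=> os; have sl0 l' : cut_sum D s l' set0 = 0.
  by apply: cut_sum_eq0 => //; have [m <-] := os; exact: outer_measure0.
elim: l E => [//|j l ih] E; rewrite inE => /orP[/eqP ->|il] /=.
  rewrite -!setIA !setIid setICr setICl !setI0 !sl0.
  by rewrite adde0 add0e.
rewrite (ih (E `&` D j))// (ih (E `&` ~` D j))// addeACA.
by congr (cut_sum D s l _ + cut_sum D s l _ + (cut_sum D s l _ + cut_sum D s l _));
  exact: setIAC.
Qed.

(** The first cut of [l] occurs in [l'], so the sum over [l'] may be split along it and induction
    treats both halves. *)
Lemma le_cut_sum s l l' E : is_outer_measure s -> {subset l <= l'} ->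
  cut_sum D s l E <= cut_sum D s l' E.
Proof.
move=> os; elim: l E => [|i l ih] E ll'; first exact: (le_cut_sum_catr D [::] l').
rewrite (@cut_sum_mem s l' i) ?ll' ?mem_head//=.
by apply: leeD; apply: ih => j jl; apply: ll'; rewrite inE jl orbT.
Qed.

End cut_sum_subset.

(** * Finite partitions with cells in a given class *)

Section set_partitions.
Context {T I : Type}.
Implicit Types (K : set (set T)) (E : set T) (Pi : seq (set T)).

(** Cells are indexed by their position in the list, so empty cells may repeat. For
    [K := measurable] this unfolds to [finite_partition]. *)
Definition is_partition K E Pi :=
  [/\ forall i, (i < size Pi)%N -> K (nth set0 Pi i),
      trivIset `I_(size Pi) (nth set0 Pi) &
      \bigcup_(i in `I_(size Pi)) nth set0 Pi i = E].

Lemma is_partition1 K E : K E -> is_partition K E [:: E].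
Proof.
move=> KE; split => [[|//] _|[|i] [|j]//|] //=.
by rewrite II1 bigcup_set1.
Qed.

Lemma is_partition_cat K E1 E2 Pi1 Pi2 : E1 `&` E2 = set0 ->
  is_partition K E1 Pi1 -> is_partition K E2 Pi2 ->
  is_partition K (E1 `|` E2) (Pi1 ++ Pi2).
Proof.
move=> E12 [K1 tr1 U1] [K2 tr2 U2].
have sub1 i : (i < size Pi1)%N -> nth set0 Pi1 i `<=` E1.
  by move=> i1; rewrite -U1; exact: bigcup_sup.
have sub2 i : (i < size Pi2)%N -> nth set0 Pi2 i `<=` E2.
  by move=> i2; rewrite -U2; exact: bigcup_sup.
have lt2 i : (size Pi1 <= i)%N -> (i < size Pi1 + size Pi2)%N ->
    (i - size Pi1 < size Pi2)%N by move=> *; rewrite ltn_subLR.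
split; rewrite ?size_cat.
- move=> i i12; rewrite nth_cat; case: ltnP => [/K1//|i1].
  exact/K2/lt2.
- have contra i j p : (i < size Pi1)%N -> (size Pi1 <= j)%N ->
      (j < size Pi1 + size Pi2)%N -> nth set0 Pi1 i p ->
      nth set0 Pi2 (j - size Pi1) p -> False.
    move=> i1 j1 j12 /(sub1 _ i1) p1 /(sub2 _ (lt2 _ j1 j12)) p2.
    by have : (E1 `&` E2) p by []; rewrite E12.
  move=> i j /= i12 j12; rewrite !nth_cat.
  case: ltnP => i1; case: ltnP => j1 -[p [pi pj]].
  + by apply: tr1 => //; exists p.
  + by case: (contra i j p).
  + by case: (contra j i p).
  + have /eqP := tr2 (i - size Pi1)%N (j - size Pi1)%N (lt2 _ i1 i12)
      (lt2 _ j1 j12) (ex_intro _ p (conj pi pj)).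
    by rewrite -(eqn_add2r (size Pi1)) !subnK// => /eqP.
- apply/seteqP; split => [p [i /= i12]|p []].
  + rewrite nth_cat; case: ltnP => i1 pi; first by left; exact: sub1 pi.
    by right; apply: sub2 pi; exact: lt2.
  + rewrite -U1 => -[i /= i1 pi]; exists i; rewrite /= ?nth_cat ?i1//.
    by rewrite ltn_addr.
  + rewrite -U2 => -[i /= i2 pi]; exists (size Pi1 + i)%N.
      by rewrite /= ltn_add2l.
    by rewrite nth_cat ltnNge leq_addr/= addKn.
Qed.

(** The cells are found before [s] is given, so one partition represents the cut sums of all set
    functions. *)
Lemma cut_sum_partition {R : realType} (D : I -> set T) K l E :
  (forall i E, K E -> K (E `&` D i) /\ K (E `&` ~` D i)) -> K E ->
  exists2 Pi, is_partition K E Pi &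
    forall s : set T -> \bar R, (cut_sum D s l E = \sum_(C <- Pi) s C)%E.
Proof.
move=> KD; elim: l E => [|i l ih] E KE.
  exists [:: E]; first exact: is_partition1.
  by move=> s; rewrite big_seq1.
have [KE1 KE2] := KD i _ KE.
have [Pi1 p1 s1] := ih _ KE1; have [Pi2 p2 s2] := ih _ KE2.
exists (Pi1 ++ Pi2); last by move=> s /=; rewrite big_cat s1 s2.
have -> : E = (E `&` D i) `|` (E `&` ~` D i) by rewrite -setIUr setUCr setIT.
apply: is_partition_cat => //.
by rewrite setIACA setICr setI0.
Qed.

End set_partitions.

(** * The measure generated by a sequence of measures and a family of cuts *)

Section measures_from_cuts.
Local Open Scope ereal_scope.
Context {R : realType} d (T : measurableType d) {I : Type} (D : I -> set T).
Implicit Types (m : nat -> {measure set T -> \bar R}) (E : set T).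

Lemma measure_cut (mu : {measure set T -> \bar R}) A B :
  measurable A -> measurable B -> mu A = mu (A `&` B) + mu (A `&` ~` B).
Proof.
move=> mA mB; rewrite -measureU.
- by rewrite -setIUr setUCr setIT.
- exact: measurableI.
- by apply: measurableI => //; exact: measurableC.
- by rewrite setIACA setICr setI0.
Qed.

Lemma sum_partition (mu : {measure set T -> \bar R}) E Pi :
  is_partition measurable E Pi -> \sum_(C <- Pi) mu C = mu E.
Proof.
move=> [mPi tr <-]; rewrite (big_nth set0) big_mkord.
rewrite (measure_fin_bigcup mu (finite_II _) tr mPi).
by rewrite -fsbig_ord.
Qed.

(** Outer measures make the supremum countably subadditive on arbitrary sets, which are the test
    sets of the Caratheodory condition. *)
Definition sup_ext m E : \bar R :=
  ereal_sup (range (fun n => (m n)^*%mu E)).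

Lemma is_outer_measure_sup_ext m : is_outer_measure (sup_ext m).
Proof. by apply: is_outer_measure_sup => n; eexists. Qed.

Lemma sup_extE m E : measurable E ->
  sup_ext m E = ereal_sup (range (fun n => m n E)).
Proof.
by move=> mE; congr ereal_sup; congr image; apply/funext => n;
  rewrite measurable_mu_extE.
Qed.

Definition cut_measure m E := cut_sup D (sup_ext m) E.

Lemma cut_measure_ge0 m E : 0 <= cut_measure m E.
Proof.
rewrite /cut_measure.
have [l <-] := is_outer_measure_cut_sup D (is_outer_measure_sup_ext m).
exact: outer_measure_ge0.
Qed.

Hypothesis mD : forall i, measurable (D i).

Lemma measurable_cut i E : measurable E ->
  measurable (E `&` D i) /\ measurable (E `&` ~` D i).
Proof.
by move=> mE; split; apply: measurableI => //; exact: measurableC.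
Qed.

(** A cut sum of [sup_ext m] is at most that of [mu], which by additivity is [mu E] whatever the
    cuts. *)
Lemma cut_measure_le m (mu : {measure set T -> \bar R}) E :
  (forall n A, measurable A -> m n A <= mu A) -> measurable E ->
  cut_measure m E <= mu E.
Proof.
move=> mmu mE; apply: ge_ereal_sup => _ [l _ <-].
elim: l E mE => [|i l ih] E mE /=.
  by rewrite sup_extE//; apply: ge_ereal_sup => _ [n _ <-]; exact: mmu.
have [mE1 mE2] := measurable_cut i mE.
by rewrite (measure_cut mu mE (mD i)) leeD ?ih.
Qed.

Lemma sup_le_cut_measure m n E : measurable E -> m n E <= cut_measure m E.
Proof.
move=> mE; apply: (le_trans _ (le_cut_sup _ _ [::] _)) => /=.
by rewrite sup_extE//; apply: ereal_sup_ubound; exists n.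
Qed.

Hypothesis gD : measurable `<=` <<s range D>>.

(** The Caratheodory sets of the outer measure form a sigma-algebra that contains every cut, hence
    by [gD] every measurable set, and the outer measure is sigma-additive on it. *)
Lemma cut_measure_measure m :
  exists mu : {measure set T -> \bar R}, mu = cut_measure m :> (set T -> \bar R).
Proof.
have os := is_outer_measure_sup_ext m.
have [l lE] := is_outer_measure_cut_sup D os.
have mcara : @measurable _ T `<=` l.-caratheodory.
  apply: (subset_trans gD).
  apply: smallest_sub.
    exact: (@sigma_algebra_measurable _ (caratheodory_type l)).
  by move=> _ [i _ <-]; rewrite lE; exact: cut_sup_caratheodory.
have sa : semi_sigma_additive (cut_measure m).
  move=> F mF tF mUF; rewrite /cut_measure -lE.
  have mF' n : l.-caratheodory (F n) by exact: mcara (mF n).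
  exact: (@caratheodory_measure_sigma_additive R T l F mF' tF (mcara _ mUF)).
have ge0 := cut_measure_ge0 m.
have c0 : cut_measure m set0 = 0 by rewrite /cut_measure -lE outer_measure0.
pose b := isMeasure.Build d T R (cut_measure m) c0 ge0 sa.
by pose mu : {measure set T -> \bar R} := HB.pack (cut_measure m) b; exists mu.
Qed.

(* [nu] is below the measure generated by the cut sums of [max nu mu], which
   coincides with [mu] on [K] and hence, by finiteness, on all subsets of [Q n]. *)
Lemma le_measure_cut (mu nu : {measure set T -> \bar R}) (K : set (set T))
    (Q : nat -> set T) :
  K `<=` measurable ->
  (forall i E, K E -> K (E `&` D i) /\ K (E `&` ~` D i)) ->
  (forall E, K E -> nu E <= mu E) ->
  (forall n, K (Q n)) -> nondecreasing_seq Q -> \bigcup_n Q n = setT ->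
  (forall n, mu (Q n) < +oo) ->
  forall E, measurable E -> nu E <= mu E.
Proof.
move=> Km KD numu KQ Qnd QT Qfin.
(* The supremum of the sequence [nu, mu, mu, ...] is the maximum of [nu] and [mu]. *)
pose m n := if n is 0%N then nu else mu.
have [la laE] := cut_measure_measure m.
have nula E : measurable E -> nu E <= la E.
  by move=> mE; rewrite laE; exact: (sup_le_cut_measure m 0).
have mula E : measurable E -> mu E <= la E.
  by move=> mE; rewrite laE; exact: (sup_le_cut_measure m 1).
have lamuK E : K E -> la E <= mu E.
  move=> KE; rewrite laE; apply: ge_ereal_sup => _ [l _ <-].
  elim: l E KE => [|i l ih] E KE /=.
    rewrite sup_extE; last exact: Km.
    by apply: ge_ereal_sup => _ [[|n] _ <-] //=; exact: numu.
  have [KE1 KE2] := KD i _ KE.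
  by rewrite (measure_cut mu (Km _ KE) (mD i)) leeD ?ih.
have mQ n : measurable (Q n) by exact/Km/KQ.
(* Pass to complements in [Q n]: [la (Q n) <= mu (Q n)], while [mu <= la] on [Q n] outside [E]; the
   mass [mu] gives to this remainder is finite and cancels. *)
have lamu n E : measurable E -> E `<=` Q n -> la E <= mu E.
  move=> mE EQ.
  have := lamuK _ (KQ n).
  rewrite (measure_cut la (mQ n) mE) (measure_cut mu (mQ n) mE) setIidr//.
  have mQE : measurable (Q n `&` ~` E).
    by apply: measurableI => //; exact: measurableC.
  have muQE : mu (Q n `&` ~` E) \is a fin_num.
    rewrite ge0_fin_numE//; apply: (le_lt_trans _ (Qfin n)).
    by apply: le_measure; rewrite ?inE.
  move=> le1; rewrite -(leeD2rE _ _ muQE); apply: le_trans le1.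
  by rewrite leeD2l// mula.
move=> E mE.
(* Continuity of [nu] from below along [Q] removes the restriction to subsets of [Q n]. *)
have EQ : E = \bigcup_n (E `&` Q n) by rewrite -setI_bigcupr QT setIT.
have mEQ n : measurable (E `&` Q n) by exact: measurableI.
have cvnu : nu (E `&` Q n) @[n --> \oo] --> nu E.
  rewrite {2}EQ; apply: nondecreasing_cvg_mu => //; first by rewrite -EQ.
  by move=> i j ij; apply/subsetPset; apply: setIS; exact/subsetPset/Qnd.
rewrite -(cvg_lim _ cvnu)//; apply: lime_le; first by apply/cvg_ex; exists (nu E).
apply: nearW => n; apply: (@le_trans _ _ (mu (E `&` Q n))).
  by apply: (le_trans (nula _ (mEQ n))); apply: (lamu n).
by apply: le_measure; rewrite ?inE.
Qed.

End measures_from_cuts.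

(** * Cuts of spacetime and grid sums *)

Section spacetime_cuts.
Context {R : realType} {U : ptopologicalType}.
Implicit Types (s t : R) (A B : set U).

Lemma measurable_fun_le_rat d (aT : measurableType d) (h : aT -> R) :
  (forall q : rat, measurable [set x | h x <= ratr q]) ->
  measurable_fun setT h.
Proof.
move=> mh; apply: (measurability _ (RGenOInfty.measurableE R)).
move=> _ [_ [r ->] <-]; rewrite setTI.
rewrite (_ : _ @^-1` _ =
    \bigcup_(q in [set q : rat | r < ratr q]) ~` [set x | h x <= ratr q]).
  rewrite bigcup_mkcond; apply: bigcupT_measurable_rat => q.
  by case: ifPn => // _; exact: measurableC.
apply/seteqP; split => [x|x [q /= rq]] /=.
  rewrite in_itv/= andbT => /rat_in_itvoo[q]; rewrite in_itv/= => /andP[rq qh].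
  by exists q => //=; apply/negP; rewrite -ltNge.
by move=> /negP; rewrite -ltNge in_itv/= andbT => qh; exact: lt_trans qh.
Qed.

Lemma borel_set_preimage (f : U -> R) (B : set R) : continuous f ->
  measurable B -> borel_set (f @^-1` B).
Proof.
move=> cf mB; have : measurable_fun setT (f : borel U -> R).
  apply: (measurability _ (RGenOpens.measurableE R)).
  move=> _ [_ [x [y ->]] <-]; rewrite setTI; apply: sub_sigma_algebra.
  by move/continuousP : cf; apply; exact: interval_open.
by move=> /(_ measurableT _ mB); rewrite setTI.
Qed.

Lemma borel_setI A B : borel_set A -> borel_set B -> borel_set (A `&` B).
Proof. exact: (@measurableI _ (borel U)). Qed.

Lemma borel_setIC A B : borel_set A -> borel_set B -> borel_set (A `&` ~` B).
Proof.
by move=> mA mB; apply: borel_setI => //; exact: (@measurableC _ (borel U)).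
Qed.

Lemma measurable_strip s t A : borel_set A -> measurable (strip s t A).
Proof.
move=> mA; have -> : strip s t A =
    [set x : Rplus R | s < sval x <= t] `*` (A : set (borel U)).
  by [].
apply: measurableX => //; exists `]s, t]%classic => //.
by rewrite setTI; apply/seteqP; split => x /=; rewrite in_itv.
Qed.

(** All times are nonnegative, so the left end [-1] keeps time 0 in the strip. *)
Lemma strip0E t A : strip0 t A = strip (-1) t A.
Proof.
apply/seteqP; split => p [tp Ap]; split => //; last by case/andP : tp.
by rewrite tp andbT (lt_le_trans _ (svalP p.1)).
Qed.

Lemma measurable_strip0 t A : borel_set A -> measurable (strip0 t A).
Proof. by rewrite strip0E; exact: measurable_strip. Qed.

Definition time_cut (q : rat) : set (spacetime R U) :=
  [set p | sval p.1 <= ratr q].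

Definition space_cut (f : U -> R) (q : rat) : set U := [set u | f u <= ratr q].

(** Rational thresholds make the index type countable, so that a supremum over lists of cuts
    preserves measurability. *)
Definition cut (f : U -> R) (i : rat + rat) : set (spacetime R U) :=
  match i with
  | inl q => time_cut q
  | inr q => [set p | space_cut f q p.2]
  end.

Variables (f : U -> R) (g : R -> U).
Hypotheses (cf : continuous f) (fK : cancel f g)
  (cg : {within range f, continuous g}).

Lemma borel_space_cut q : borel_set (space_cut f q).
Proof.
rewrite (_ : space_cut f q = f @^-1` `]-oo, ratr q]).
  by apply: borel_set_preimage.
by apply/seteqP; split => x /=; rewrite in_itv.
Qed.

Lemma measurable_cut_spacetime i : measurable (cut f i).
Proof.
case: i => q.
- rewrite (_ : cut f (inl q) =
      [set x : Rplus R | sval x <= ratr q] `*` [set: borel U]).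
    apply: measurableX => //; exists `]-oo, (ratr q)]%classic => //.
    by rewrite setTI; apply/seteqP; split => x /=; rewrite in_itv.
  by apply/seteqP; split => p //= [].
- rewrite (_ : cut f (inr q) =
      [set: Rplus R] `*` (space_cut f q : set (borel U))).
    by apply: measurableX => //; exact: borel_space_cut.
  by apply/seteqP; split => p //= [].
Qed.

(** Preimages of Borel sets of [R] form a sigma-algebra. It contains each open [O]: the preimage of
    [O] under [g] is relatively open in [range f], hence the trace of some open [V], and pulling [V]
    back by [f] returns [O]. *)
Lemma borel_embedding_preimage B : borel_set B ->
  exists2 C : set R, measurable C & f @^-1` C = B.
Proof.
move: B; apply: smallest_sub.
  split; first by exists set0 => //; rewrite preimage_set0.
  - by move=> _ [C mC <-]; exists (~` C); [exact: measurableC|rewrite setTD].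
  - move=> F FP; have F' n := cid2 (FP n); exists (\bigcup_n sval (F' n)).
      by apply: bigcupT_measurable => n; case: (F' n).
    by rewrite preimage_bigcup; apply: eq_bigcupr => n _; case: (F' n).
move=> O oO; have /open_subspaceP[V oV VO] : open (g @^-1` O : set (subspace (range f))).
  by move/continuousP : cg; exact.
exists V; first exact: open_measurable.
apply/seteqP; split => x /=.
  move=> Vfx; have : (g @^-1` O `&` range f) (f x) by rewrite -VO; split => //; exists x.
  by move=> [] /=; rewrite fK.
move=> Ox; have : (V `&` range f) (f x).
  by rewrite VO; split; [rewrite /= fK|exists x].
by move=> [].
Qed.

(** The cuts make the time and the [f]-value of the position measurable, and each generator of the
    product sigma-algebra is a preimage under one of these two maps. *)
Lemma measurable_spacetime_cuts :
  @measurable _ (spacetime R U) `<=` <<s range (cut f)>>.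
Proof.
have mt : measurable_fun setT
    ((fun p => sval p.1) : g_sigma_algebraType (range (cut f)) -> R).
  apply: measurable_fun_le_rat => q; apply: sub_sigma_algebra.
  by exists (inl q).
have mu : measurable_fun setT
    ((fun p => f p.2) : g_sigma_algebraType (range (cut f)) -> R).
  apply: measurable_fun_le_rat => q; apply: sub_sigma_algebra.
  by exists (inr q).
apply: smallest_sub; first exact: smallest_sigma_algebra.
move=> _ [[_ [B mB <-] <-]|[B mB <-]]; rewrite !setTI.
- by have := mt measurableT _ mB; rewrite setTI.
- have [C mC <-] := borel_embedding_preimage mB.
  by have := mu measurableT _ mC; rewrite setTI.
Qed.

End spacetime_cuts.

(** * Cut sums of strips and grid sums *)

Section grids.
Context {R : realType} {U : ptopologicalType}.
Implicit Types (a b t : R) (A B : set U) (c : seq rat).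

Lemma strip_time_cut a b A q :
  strip a b A `&` time_cut q = strip a (Num.min b (ratr q)) A.
Proof.
apply/seteqP; split => p; rewrite /strip /time_cut /= le_min.
  by move=> [[/andP[-> ->] Ap] ->].
by move=> [/and3P[-> -> ->] Ap].
Qed.

Lemma strip_time_cutC a b A q :
  strip a b A `&` ~` time_cut q = strip (Num.max a (ratr q)) b A.
Proof.
apply/seteqP; split => p; rewrite /strip /time_cut /= gt_max.
  by move=> [[/andP[-> ->] Ap] /negP]; rewrite -ltNge => ->.
by move=> [/andP[/andP[-> qp] ->] Ap]; split => //; apply/negP; rewrite -ltNge.
Qed.

Lemma strip_space_cut a b A B :
  strip a b A `&` [set p | B p.2] = strip a b (A `&` B).
Proof. by apply/seteqP; split => p [] => [[ap Ap] Bp|ap [Ap Bp]]. Qed.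

Lemma strip_space_cutC a b A B :
  strip a b A `&` ~` [set p | B p.2] = strip a b (A `&` ~` B).
Proof. exact: (strip_space_cut a b A (~` B)). Qed.

Lemma strip_empty a b A : b <= a -> strip a b A = set0.
Proof.
move=> ba; apply/seteqP; split => // p [/andP[ap pb] _].
by have := lt_le_trans ap (le_trans pb ba); rewrite ltxx.
Qed.

Variable f : U -> R.

Lemma cut_sum_strip (s : set (spacetime R U) -> \bar R) us a b A :
  cut_sum (cut f) s (map inr us) (strip a b A) =
  cut_sum (space_cut f) (fun B => s (strip a b B)) us A.
Proof.
elim: us A => [//|q us ih] A /=.
by rewrite strip_space_cut strip_space_cutC !ih.
Qed.

(** The pairs of consecutive points in the subdivision of the interval from [a] to [b] at the
    rationals [c]. *)
Definition steps a c b := zip (a :: map ratr c) (rcons (map ratr c) b).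

(** A time cut outside the open interval from [a] to [b] leaves one side empty and drops out; one
    inside splits the strip, and the chains of the two halves are joined at [q]. The same [c] serves
    every [A]. *)
Lemma cut_sum_time_chain (s : set (spacetime R U) -> \bar R) ts l a b :
  is_outer_measure s -> a < b ->
  exists2 c, path <%R a (rcons (map ratr c) b) &
    forall A, (cut_sum (cut f) s (map inl ts ++ l) (strip a b A) =
      \sum_(x <- steps a c b) cut_sum (cut f) s l (strip x.1 x.2 A))%E.
Proof.
move=> os; have cs0 l' : cut_sum (cut f) s l' set0 = 0%E.
  by apply: cut_sum_eq0 => //; have [m <-] := os; exact: outer_measure0.
elim: ts a b => [|q ts ih] a b ab.
  by exists [::]; rewrite /= ?ab// => A; rewrite big_seq1.
have [qa|aq] := leP (ratr q) a.
  have [c pc cE] := ih _ _ ab; exists c => // A.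
  rewrite /= strip_time_cut strip_time_cutC (max_idPl qa) strip_empty; last first.
    by rewrite ge_min qa orbT.
  by rewrite cs0 add0e cE.
have [bq|qb] := leP b (ratr q).
  have [c pc cE] := ih _ _ ab; exists c => // A.
  rewrite /= strip_time_cut strip_time_cutC (min_idPl bq).
  rewrite [strip (Num.max _ _) _ _]strip_empty; last first.
    by rewrite le_max bq orbT.
  by rewrite cs0 adde0 cE.
have [c1 pc1 cE1] := ih _ _ aq; have [c2 pc2 cE2] := ih _ _ qb.
exists (c1 ++ q :: c2).
  by rewrite map_cat rcons_cat /= -cat_rcons cat_path pc1 last_rcons.
move=> A; rewrite /= strip_time_cut strip_time_cutC (max_idPr (ltW aq)).
rewrite (min_idPr (ltW qb)) cE1 cE2 -big_cat -zip_cat ?size_rcons//.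
by rewrite /steps map_cat rcons_cat /= cat_rcons.
Qed.

(** Sorting the cuts of [l] with time before space cannot lower the cut sum; after sorting, every
    time step is cut by the same space cuts, so the cells form a grid. *)
Lemma cut_sum_le_grid (s : set (spacetime R U) -> \bar R) t A l :
  is_outer_measure s -> continuous f -> 0 < t -> borel_set A ->
  exists2 Pi, grid_partition t A Pi &
    (cut_sum (cut f) s l (strip 0%R t A) <= \sum_(C <- Pi) s C)%E.
Proof.
move=> os cf t0 mA.
pose ts : seq rat := pmap (fun i : rat + rat => if i is inl q then Some q else None) l.
pose us : seq rat := pmap (fun i : rat + rat => if i is inr q then Some q else None) l.
have [c pc cE] := cut_sum_time_chain ts (map inr us) os t0.
have cutK q E : borel_set E ->
    borel_set (E `&` space_cut f q) /\ borel_set (E `&` ~` space_cut f q).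
  have mq := borel_space_cut cf q.
  by move=> mE; split; [exact: borel_setI|exact: borel_setIC].
have [Ps [mPs trPs UPs] sPs] := cut_sum_partition (R := R) us cutK mA.
(* The time points are [0], the rationals in [c] and finally [t], so there is one step more than [c]
   has entries. *)
pose tau := nth t (0 :: rcons (map ratr c) t).
have [k kE] : exists k, k = (size c).+1 by eexists.
exists [seq strip (tau i) (tau i.+1) (nth set0 Ps j) |
          i <- iota 0 k, j <- iota 0 (size Ps)].
  exists k, (size Ps), tau, (nth set0 Ps); split => //; split => //.
  - by rewrite /tau kE /= nth_rcons size_map ltnn eqxx.
  - by move=> i; rewrite kE => ik; apply: (pathP t pc); rewrite size_rcons size_map.
  - rewrite kE; case=> [_|i /ltnSE ik]; first by exists 0%R; rewrite rmorph0.
    exists (nth 0%R c i).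
    by rewrite /tau /= nth_rcons size_map ik (nth_map 0%R).
apply: (@le_trans _ _ (cut_sum (cut f) s (map inl ts ++ map inr us) (strip 0%R t A))).
  apply: le_cut_sum => // -[q|q] ql; rewrite mem_cat; apply/orP.
    by left; apply: map_f; rewrite mem_pmap; apply/mapP; exists (inl q).
  by right; apply: map_f; rewrite mem_pmap; apply/mapP; exists (inr q).
rewrite cE big_allpairs_dep /steps (big_nth (t, t)) size_zip size_rcons /=.
rewrite !size_map minnn -kE big_mkord -[in X in (_ <= X)%E](subn0 k) big_mkord.
apply: lee_sum => i _; rewrite nth_zip ?size_rcons//= cut_sum_strip sPs.
rewrite (big_nth set0) /index_iota subn0.
rewrite (_ : nth t (0 :: [seq ratr i | i <- c])%R i = tau i) //.
by rewrite /tau /= -rcons_cons nth_rcons /= size_map -kE ltn_ord.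
Qed.

(** The space cells add up to [A] and the time steps to the interval from 0, excluded, to [t]; only
    the mass at time 0 is left out. *)
Lemma sum_grid_le (mu : {measure set (spacetime R U) -> \bar R}) t A Pi :
  0 <= t -> borel_set A -> grid_partition t A Pi ->
  (\sum_(C <- Pi) mu C <= mu (strip0 t A))%E.
Proof.
move=> t0 mA [k [m [tau [Aj [[tau0 tauk taulx _] [mAj trA UA] ->]]]]].
rewrite big_allpairs_dep -[in X in (X <= _)%E](subn0 k) big_mkord.
have sumA a b : (\sum_(j <- iota 0 m) mu (strip a b (Aj j)) = mu (strip a b A))%E.
  rewrite -[in LHS](subn0 m) big_mkord.
  have -> : strip a b A = \bigcup_(j in `I_m) strip a b (Aj j).
    rewrite -UA; apply/seteqP; split => p.
      by move=> [abp [j jm Ap]]; exists j.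
    by move=> [j jm [abp Ap]]; split => //; exists j.
  rewrite (measure_fin_bigcup mu (finite_II m)).
  - by rewrite -fsbig_ord.
  - by move=> i j im jm [p [[_ ip] [_ jp]]]; apply: (trA i j im jm); exists p.2.
  - by move=> j jm; apply: measurable_strip; exact: mAj.
under eq_bigr => i _ do rewrite sumA.
apply: (@le_trans _ _ (mu (strip 0%R t A))); last first.
  apply: le_measure; rewrite ?inE; [exact: measurable_strip|exact: measurable_strip0|].
  by move=> p [/andP[_ tp] Ap].
have tau_ge0 n : (n <= k)%N -> 0 <= tau n.
  elim: n => [|n ih] nk; first by rewrite tau0.
  by rewrite (le_trans (ih (ltnW nk)))// ltW// taulx.
rewrite -tauk.
suff strips n : (n <= k)%N ->
    (\sum_(i < n) mu (strip (tau i) (tau i.+1) A) <= mu (strip 0%R (tau n) A))%E.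
  exact: strips.
elim: n => [|n ih] nk; first by rewrite big_ord0 measure_ge0.
rewrite big_ord_recr /=.
have -> : strip 0%R (tau n.+1) A = strip 0%R (tau n) A `|` strip (tau n) (tau n.+1) A.
  apply/seteqP; split => p.
    move=> [/andP[p0 pn] Ap]; have [pt|tp] := leP (sval p.1) (tau n).
      by left; split => //; rewrite p0.
    by right; split => //; rewrite tp.
  move=> [[/andP[p0 pn] Ap]|[/andP[p0 pn] Ap]]; split => //; apply/andP; split => //.
    by rewrite (le_trans pn)// ltW// taulx.
  by rewrite (le_lt_trans _ p0)// tau_ge0// ltnW.
rewrite measureU; [|exact: measurable_strip..|].
  by apply: leeD => //; apply: ih; exact: ltnW.
apply/seteqP; split => // p [[/andP[_ pn] _] [/andP[np _] _]].
by have := lt_le_trans np pn; rewrite ltxx.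
Qed.

End grids.

(** * Partition formula, grid formula and comparison of measures on strips *)

Section spacetime_measures.
Local Open Scope ereal_scope.
Context {R : realType} {U : ptopologicalType}.
Implicit Types (E : set (spacetime R U)).
Implicit Types (t : R) (A : set U).

Lemma strips_nondecreasing (Un : nat -> set U) : nondecreasing_seq Un ->
  nondecreasing_seq (fun n => strip0 n%:R (Un n) : set (spacetime R U)).
Proof.
move=> Und i j ij; apply/subsetPset => p [pi Up]; split.
  by rewrite (le_trans pi)// ler_nat.
by have /subsetPset := Und _ _ ij; apply.
Qed.

Lemma strips_cover (Un : nat -> set U) : nondecreasing_seq Un ->
  \bigcup_n Un n = setT ->
  \bigcup_n (strip0 n%:R (Un n) : set (spacetime R U)) = setT.
Proof.
move=> Und UT; apply/seteqP; split => // p _.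
have [n _ Up] : (\bigcup_n Un n) p.2 by rewrite UT.
have [k pk] : exists k : nat, (sval p.1 <= k%:R)%R.
  by exists (Num.bound (sval p.1)); rewrite ltW// archi_boundP// (svalP p.1).
exists (maxn k n) => //; split.
  by rewrite (le_trans pk)// ler_nat leq_maxl.
by have /subsetPset := Und _ _ (leq_maxr k n); apply.
Qed.

Lemma le_sum_partition (s1 s2 : set (spacetime R U) -> \bar R) E Pi :
  finite_partition E Pi ->
  (forall C, measurable C -> s1 C <= s2 C) ->
  \sum_(C <- Pi) s1 C <= \sum_(C <- Pi) s2 C.
Proof.
move=> [mPi _ _] s12; rewrite !(big_nth set0) !big_mkord.
by apply: lee_sum => i _; apply: s12; exact: mPi.
Qed.

Lemma le_sum_grid (s1 s2 : set (spacetime R U) -> \bar R) t A Pi :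
  borel_set A -> grid_partition t A Pi ->
  (forall C, measurable C -> s1 C <= s2 C) ->
  \sum_(C <- Pi) s1 C <= \sum_(C <- Pi) s2 C.
Proof.
move=> mA [k [m [tau [Aj [_ [mAj _ _] ->]]]]] s12.
rewrite !big_allpairs_dep; apply: lee_sum => i _.
rewrite big_seq [leRHS]big_seq; apply: lee_sum => j; rewrite mem_iota => jm.
by apply: s12; apply: measurable_strip; exact: mAj.
Qed.

Variables (f : U -> R) (g : R -> U).
Hypotheses (cf : continuous f) (fK : cancel f g)
  (cg : {within range f, continuous g}).
Let mcut := measurable_cut_spacetime cf.
Let gcut := measurable_spacetime_cuts fK cg.
Implicit Type m : nat -> {measure set (spacetime R U) -> \bar R}.

(** A cut sum is the sum over the partition into its cells. Conversely the generated measure is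
    additive over any partition and lies above each [m n] on every cell. *)
Lemma cut_measure_supE m E : measurable E ->
  cut_measure (cut f) m E = measure_sup (fun n => m n) E.
Proof.
move=> mE; have [mu muE] := cut_measure_measure gcut m.
apply/eqP; rewrite eq_le; apply/andP; split.
  apply: ge_ereal_sup => _ [l _ <-].
  have [Pi PiE ->] := cut_sum_partition (R := R) l (measurable_cut mcut) mE.
  apply: le_ereal_sup_tmp; exists (\sum_(C <- Pi) ereal_sup (range (fun n => m n C))).
    by exists Pi.
  by apply: (le_sum_partition PiE) => C mC; rewrite sup_extE.
apply: ge_ereal_sup => _ [Pi PiE <-]; rewrite -muE -(sum_partition mu PiE).
apply: (le_sum_partition PiE) => C mC; apply: ge_ereal_sup => _ [n _ <-].
by rewrite muE; exact: sup_le_cut_measure.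
Qed.

(** Grid cells miss time 0, where the generated measure vanishes because all [m n] do. On the
    remaining strip, cut sums and grid sums bound each other through [cut_sum_le_grid] and
    [sum_grid_le]. *)
Lemma cut_measure_gridE m t A : (forall n, m n (strip0 0%R setT) = 0) ->
  (0 <= t)%R -> borel_set A ->
  cut_measure (cut f) m (strip0 t A) =
  ereal_sup [set \sum_(C <- Pi) ereal_sup (range (fun n => m n C)) |
             Pi in grid_partition t A].
Proof.
move=> m0 t0 mA; have [mu muE] := cut_measure_measure gcut m.
have os := is_outer_measure_sup_ext m.
have mU : borel_set [set: U] by exact: (@measurableT _ (borel U)).
have mu0 : mu (strip0 0%R setT) = 0.
  rewrite muE; apply: cut_sup_eq0 => //; rewrite sup_extE; last exact: measurable_strip0.
  rewrite -(ereal_sup1 0); congr ereal_sup; apply/seteqP.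
  by split => [_ [n _ <-]|_ ->] /=; [exact: m0|exists 0%N].
apply/eqP; rewrite eq_le; apply/andP; split; last first.
  apply: ge_ereal_sup => _ [Pi PiA <-].
  rewrite -muE; apply: le_trans (sum_grid_le mu t0 mA PiA).
  apply: (le_sum_grid mA PiA) => C mC; apply: ge_ereal_sup => _ [n _ <-].
  by rewrite muE; exact: sup_le_cut_measure.
have sup_ge0 : 0 <= ereal_sup
    [set \sum_(C <- Pi) ereal_sup (range (fun n => m n C)) | Pi in grid_partition t A].
  have [Pi PiA _] : exists2 Pi, grid_partition t A Pi & True.
    move: t0; rewrite le_eqVlt => /orP[/eqP <-|t0].
      (* At [t = 0] the grid has no time step, and its list of cells is empty. *)
      exists [::] => //; exists 0%N, 1%N, (fun=> 0%R), (fun=> A); split => //.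
      split => //; first by move=> [|i] [|j].
      by rewrite II1 bigcup_set1.
    by have [Pi PiA _] := cut_sum_le_grid [::] os cf t0 mA; exists Pi.
  apply: le_ereal_sup_tmp.
  exists (\sum_(C <- Pi) ereal_sup (range (fun n => m n C))); first by exists Pi.
  apply: sume_ge0 => C _; apply: le_ereal_sup_tmp.
  by exists (m 0%N C) => //; exists 0%N.
have strip00 : strip0 t A `<=` strip0 0%R setT `|` strip 0%R t A.
  move=> p [pt Ap]; have [p0|p0] := leP (sval p.1) 0%R; first by left.
  by right; split => //; rewrite p0.
have m00 : measurable (strip0 0%R [set: U] : set (spacetime R U)).
  exact: measurable_strip0.
have mst : measurable (strip 0%R t A : set (spacetime R U)).
  exact: measurable_strip.
rewrite -muE; apply: (@le_trans _ _ (mu (strip 0%R t A))).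
  apply: (@le_trans _ _ (mu (strip0 0%R setT `|` strip 0%R t A))).
    by apply: le_measure; rewrite ?inE//; [exact: measurable_strip0|exact: measurableU].
  by apply: (le_trans (measureU2 _ m00 mst)); rewrite [X in X + _]mu0 add0e.
move: t0; rewrite le_eqVlt => /orP[/eqP t0|t0].
  by rewrite -{1}t0 strip_empty ?lexx// measure0.
rewrite muE; apply: ge_ereal_sup => _ [l _ <-].
have [Pi PiA /le_trans->//] := cut_sum_le_grid l os cf t0 mA.
apply: le_ereal_sup_tmp.
exists (\sum_(C <- Pi) ereal_sup (range (fun n => m n C))); first by exists Pi.
by apply: (le_sum_grid mA PiA) => C mC; rewrite sup_extE.
Qed.

(** The strips with rational ends over Borel subsets of some [Un n] are stable under all cuts, so
    [le_measure_cut] applies to them. A negative left end is moved to 0, since [nu] has no mass at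
    time 0. *)
Lemma le_measure_strips (mu nu : {measure set (spacetime R U) -> \bar R})
    (Un : nat -> set U) :
  (forall n, borel_set (Un n)) -> nondecreasing_seq Un ->
  \bigcup_n Un n = setT ->
  (forall n, mu (strip0 n%:R (Un n)) < +oo) ->
  nu (strip0 0%R setT) = 0 ->
  (forall s (q : rat) n A, (0 <= s)%R -> (s < ratr q)%R -> borel_set A ->
    A `<=` Un n -> nu (strip s (ratr q) A) <= mu (strip s (ratr q) A)) ->
  forall E, measurable E -> nu E <= mu E.
Proof.
move=> mUn Und UT mufin nu0 numu.
pose K E := exists (a b : rat) n A,
  [/\ borel_set A, A `<=` Un n & E = strip (ratr a) (ratr b) A].
have mU : borel_set [set: U] by exact: (@measurableT _ (borel U)).
have m00 : measurable (strip0 0%R [set: U] : set (spacetime R U)).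
  exact: measurable_strip0.
apply: (@le_measure_cut _ _ _ _ (cut f) mcut gcut mu nu K
  (fun n => strip0 n%:R (Un n))).
- by move=> _ [a [b [n [A [mA _ ->]]]]]; exact: measurable_strip.
- move=> i _ [a [b [n [A [mA AU ->]]]]]; case: i => q /=.
    rewrite strip_time_cut strip_time_cutC; split.
      exists a, (if b <= q then b else q)%R, n, A; split => //.
      by rewrite minEle ler_rat; case: ifP.
    exists (if a <= q then q else a)%R, b, n, A; split => //.
    by rewrite maxEle ler_rat; case: ifP.
  have mq := borel_space_cut cf q.
  rewrite strip_space_cut strip_space_cutC; split.
    exists a, b, n, (A `&` space_cut f q); split => //; first exact: borel_setI.
    by move=> x [/AU].
  exists a, b, n, (A `&` ~` space_cut f q); split => //; first exact: borel_setIC.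
  by move=> x [/AU].
- move=> _ [a [b [n [A [mA AU ->]]]]].
  have [ba|ab] := leP (ratr b : R) (ratr a).
    by rewrite strip_empty// !measure0.
  have [a0|a0] := leP 0%R (ratr a : R); first exact: numu mA AU.
  have mst s t : measurable (strip s t A : set (spacetime R U)).
    exact: measurable_strip.
  apply: (@le_trans _ _ (nu (strip 0%R (ratr b) A))).
    apply: (@le_trans _ _ (nu (strip0 0%R setT `|` strip 0%R (ratr b) A))).
      apply: le_measure; rewrite ?inE//; first exact: measurableU.
      move=> p [/andP[_ pb] Ap]; have [p0|p0] := leP (sval p.1) 0%R; first by left.
      by right; split => //; rewrite p0.
    by apply: (le_trans (measureU2 _ m00 (mst _ _))); rewrite [X in X + _]nu0 add0e.
  apply: (@le_trans _ _ (mu (strip 0%R (ratr b) A))).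
    have [b0|b0] := leP (ratr b : R) 0%R; first by rewrite strip_empty// !measure0.
    exact: numu mA AU.
  apply: le_measure; rewrite ?inE// => p [/andP[p0 pb] Ap]; split => //.
  by rewrite pb (lt_trans a0).
- move=> n; exists (-1)%R, n%:R%R, n, (Un n); split => //.
  by rewrite strip0E rmorphN1 ratr_nat.
- exact: strips_nondecreasing.
- exact: strips_cover.
- exact: mufin.
Qed.

End spacetime_measures.

(** * Measurability and predictability *)

Section measurable_cut_measure.
Local Open Scope ereal_scope.

Lemma measurable_fun_ereal_sup_countable d (T : measurableType d) (R : realType)
    (J : countType) (h : J -> T -> \bar R) :
  (forall j, measurable_fun setT (h j)) ->
  measurable_fun setT (fun x => ereal_sup (range (h ^~ x))).
Proof.
move=> mh.
(* Numbers that encode no element of [J] get [-oo], which is neutral for suprema. *)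
pose u n x := if @unpickle J n is Some j then h j x else -oo.
have mu n : measurable_fun setT (u n).
  by rewrite /u; case: unpickle => [j|]; [exact: mh|exact: measurable_cst].
rewrite (_ : (fun x => _) = (fun x => esups (u ^~ x) 0%N)).
  exact: measurable_fun_esups.
apply/funext => x; rewrite /esups; apply/eqP; rewrite eq_le; apply/andP; split.
  apply: ge_ereal_sup => _ [j _ <-]; apply: ereal_sup_ubound.
  by exists (pickle j) => //; rewrite /u pickleK.
apply: ge_ereal_sup => _ [n _ <-]; rewrite /u; case: unpickle => [j|].
  by apply: ereal_sup_ubound; exists j.
by rewrite leNye.
Qed.

(** Lists over [I] are countable, so this is a countable supremum of finite sums of countable
    suprema. The moving window [W x] serves predictability, where the parameter contains a time and
    the window is spacetime up to it. *)
Lemma measurable_cut_measure {R : realType} d (T : measurableType d)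
    d' (S : measurableType d') {I : countType} (D : I -> set T)
    (m : nat -> S -> {measure set T -> \bar R}) (W : S -> set T) :
  (forall i, measurable (D i)) -> (forall x, measurable (W x)) ->
  (forall n E, measurable E -> measurable_fun setT (fun x => m n x (E `&` W x))) ->
  forall E, measurable E ->
    measurable_fun setT (fun x => cut_measure D (m ^~ x) (E `&` W x)).
Proof.
move=> mD mW mm E mE; rewrite /cut_measure /cut_sup.
apply: measurable_fun_ereal_sup_countable => l.
elim: l E mE => [|i l ih] E mE /=.
  rewrite (_ : (fun x => _) =
      fun x => ereal_sup (range (fun n => m n x (E `&` W x)))).
    by apply: measurable_fun_ereal_sup_countable => n; exact: mm.
  by apply/funext => x; rewrite sup_extE//; exact: measurableI.
have [mE1 mE2] := measurable_cut mD i mE.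
rewrite (_ : (fun x => _) = fun x =>
    cut_sum D (sup_ext (m ^~ x)) l (E `&` D i `&` W x) +
    cut_sum D (sup_ext (m ^~ x)) l (E `&` ~` D i `&` W x)).
  by apply: emeasurable_funD; exact: ih.
by apply/funext => x; rewrite (setIAC E (D i)) (setIAC E (~` D i)).
Qed.

End measurable_cut_measure.

(** * Predictability of a measure restricted to a running time interval *)

Section predictable_measures.
Context {R : realType} d (T : measurableType d).
Context (F : R -> set (set T)) (U : ptopologicalType).

Let PT := g_sigma_algebraType (predictable_rect F).

Lemma predictable_Ioc s t A : 0 <= s -> F s A ->
  measurable (A `*` [set r : Rplus R | s < sval r <= t] : set PT).
Proof.
move=> s0 FA; have [st|ts] := ltP s t.
  by apply: sub_sigma_algebra; right; exists s, t, A.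
rewrite (_ : _ `*` _ = set0); first exact: measurable0.
apply/seteqP; split => // -[w r] /= [_ /andP[sr rt]].
by have := lt_le_trans sr (le_trans rt ts); rewrite ltxx.
Qed.

Lemma predictable_Ioy s A : 0 <= s -> F s A ->
  measurable (A `*` [set r : Rplus R | s < sval r] : set PT).
Proof.
move=> s0 FA; rewrite (_ : _ `*` _ =
    \bigcup_n (A `*` [set r : Rplus R | s < sval r <= n%:R])).
  by apply: bigcupT_measurable => n; exact: predictable_Ioc.
apply/seteqP; split => [[w r] [Aw sr]|[w r] [n _ [Aw /andP[sr _]]]] //.
exists (Num.bound (sval r)) => //; split => //=; apply/andP; split => //.
by rewrite ltW// archi_boundP// (svalP r).
Qed.

Lemma predictable_cylinder A : F 0 A ->
  measurable (A `*` [set: Rplus R] : set PT).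
Proof.
move=> FA; rewrite (_ : _ `*` _ = A `*` [set r : Rplus R | sval r = 0] `|`
    A `*` [set r : Rplus R | 0 < sval r]).
  apply: measurableU; last exact: predictable_Ioy.
  by apply: sub_sigma_algebra; left; exists A.
apply/seteqP; split => [[w r] [Aw _]|[w r] []] /=; last by move=> [].
  have := svalP r; rewrite /= le_eqVlt => /orP[/eqP r0|r0]; [left|right] => //.
by move=> [].
Qed.

Definition stop (q r : Rplus R) : Rplus R := if sval r <= sval q then r else q.

Lemma sval_stop q r : sval (stop q r) = Num.min (sval r) (sval q).
Proof. by rewrite /stop minEle; case: ifP. Qed.

(** Stopping at [q] pulls a predictable rectangle over the times from [s] to [t] back to the empty
    set, to all times after [s], or to itself, according to the place of [q]. The rectangle at time
    0 is unchanged, unless [q = 0], when it becomes a full cylinder. *)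
Lemma measurable_fun_stop q :
  measurable_fun setT ((fun p => (p.1, stop q p.2)) : PT -> PT).
Proof.
apply: (@measurability _ _ PT PT _ _ (predictable_rect F)) => //.
move=> _ [C [[A FA ->]|[s [t [A [s0 st FA ->]]]]] <-]; rewrite setTI.
  have := svalP q; rewrite le_eqVlt => /orP[/eqP q0|q0].
    rewrite (_ : _ @^-1` _ = A `*` setT); first exact: predictable_cylinder.
    apply/seteqP; split => -[w r] [Aw] //= _; split => //=.
    by rewrite sval_stop -q0; apply/min_idPr; exact: (svalP r).
  rewrite (_ : _ @^-1` _ = A `*` [set r : Rplus R | sval r = 0]).
    by apply: sub_sigma_algebra; left; exists A.
  apply/seteqP; split => -[w r] [/= Aw]; rewrite sval_stop => r0; split => //=.
    by move: r0; rewrite minEle; case: ifP => // _ q0'; move: q0; rewrite q0' ltxx.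
  by rewrite r0; apply/min_idPl; exact: (svalP q).
have [qs|sq] := leP (sval q) s.
  rewrite (_ : _ @^-1` _ = set0); first exact: measurable0.
  apply/seteqP; split => // -[w r] [/= _]; rewrite sval_stop => /andP[].
  by rewrite lt_min => /andP[_ /(le_lt_trans qs)]; rewrite ltxx.
have [qt|tq] := leP (sval q) t.
  rewrite (_ : _ @^-1` _ = A `*` [set r : Rplus R | s < sval r]).
    exact: predictable_Ioy.
  apply/seteqP; split => -[w r] [/= Aw]; rewrite sval_stop.
    by rewrite lt_min => /andP[/andP[sr _] _].
  by move=> sr; split => //=; rewrite lt_min ge_min sr sq qt orbT.
rewrite (_ : _ @^-1` _ = A `*` [set r : Rplus R | s < sval r <= t]).
  exact: predictable_Ioc.
apply/seteqP; split => -[w r] [/= Aw]; rewrite sval_stop lt_min ge_min sq andbT.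
  by rewrite (leNgt (sval q)) tq orbF.
by move=> /andP[sr rt]; split => //=; rewrite sr rt.
Qed.

Lemma strip0I (s t : R) (A B : set U) :
  strip0 s A `&` strip0 t B = strip0 (Num.min s t) (A `&` B).
Proof.
apply/seteqP; split => p; rewrite /strip0 /= le_min.
  by move=> [[-> Ap] [-> Bp]].
by move=> [/andP[-> ->] [Ap Bp]].
Qed.

Lemma measurable_spacetime_strips :
  @measurable _ (spacetime R U) =
  <<s [set E | exists t A, borel_set A /\ E = strip0 t A] >>.
Proof.
have mU : borel_set [set: U] by exact: (@measurableT _ (borel U)).
apply/seteqP; split; last first.
  apply: smallest_sub; first exact: sigma_algebra_measurable.
  by move=> _ [t [A [mA ->]]]; exact: measurable_strip0.
set G := [set E | _].
have mt : measurable_fun setT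
    ((fun p => sval p.1) : g_sigma_algebraType G -> R).
  apply: measurable_fun_le_rat => q; apply: sub_sigma_algebra.
  exists (ratr q), setT; split => //.
  by apply/seteqP; split => p // [].
apply: smallest_sub; first exact: smallest_sigma_algebra.
move=> _ [[_ [B mB <-] <-]|[B mB <-]]; rewrite !setTI.
- by have := mt measurableT _ mB; rewrite setTI.
- rewrite (_ : _ @^-1` _ = \bigcup_n (strip0 n%:R (B : set U))).
    apply: (@bigcupT_measurable _ (g_sigma_algebraType G)) => n.
    by apply: sub_sigma_algebra; exists n%:R, B.
  apply/seteqP; split => [p Bp|p [n _ []]] //.
  exists (Num.bound (sval p.1)) => //; split => //.
  by rewrite ltW// archi_boundP// (svalP p.1).
Qed.

(** For a strip, the running time is stopped at the end of the strip, and [measurable_fun_stop]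
    applies. Dynkin induction inside the finite windows [Q n], where complements are differences,
    reaches all [E]; then [n] tends to infinity. *)
Lemma predictable_strip_measure (m : T -> {measure set (spacetime R U) -> \bar R})
    (Un : nat -> set U) :
  (forall n, borel_set (Un n)) -> nondecreasing_seq Un ->
  \bigcup_n Un n = setT ->
  (forall w n, (m w (strip0 n%:R (Un n)) < +oo)%E) ->
  predictable_measure F (fun w => m w : set _ -> \bar R) ->
  forall E, measurable E ->
    measurable_fun setT
      ((fun p => m p.1 (E `&` strip0 (sval p.2) setT)) : PT -> \bar R).
Proof.
move=> mUn Und UT mfin mpred.
have mU : borel_set [set: U] by exact: (@measurableT _ (borel U)).
have mS t : measurable (strip0 t setT : set (spacetime R U)).
  exact: measurable_strip0.
pose Q n : set (spacetime R U) := strip0 n%:R (Un n).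
have mQ n : measurable (Q n) by exact: measurable_strip0.
have pstrip t A : borel_set A -> measurable_fun setT
    ((fun p => m p.1 (strip0 t A `&` strip0 (sval p.2) setT)) : PT -> \bar R).
  move=> mA; have [t0|t0] := leP 0 t.
    have := measurableT_comp (mpred _ mA)
      (measurable_fun_stop (exist _ t t0 : Rplus R)).
    apply: eq_measurable_fun => p _ /=.
    by rewrite strip0I sval_stop minC setIT.
  rewrite (_ : (fun p => _) = cst 0%E); first exact: measurable_cst.
  apply/funext => p; rewrite (_ : _ `&` _ = set0) ?measure0//.
  apply/seteqP; split => // x [[xt _] _].
  by have := lt_le_trans t0 (svalP x.1); rewrite ltNge xt.
have key n E : measurable E -> measurable_fun setT
    ((fun p => m p.1 (E `&` (Q n `&` strip0 (sval p.2) setT))) : PT -> \bar R).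
  rewrite measurable_spacetime_strips; move: E.
  have mW (p : PT) : measurable (Q n `&` strip0 (sval p.2) setT).
    exact: measurableI.
  have Wfin (p : PT) E : measurable E ->
      (m p.1 (E `&` (Q n `&` strip0 (sval p.2) setT)) < +oo)%E.
    move=> mE; apply: le_lt_trans (mfin p.1 n).
    apply: le_measure; rewrite ?inE.
    - exact: measurableI.
    - exact: mQ.
    - by move=> x [_ []].
  apply: (dynkin_induction measurable_spacetime_strips).
  - move=> _ _ [s [A [mA ->]]] [t [B [mB ->]]].
    exists (Num.min s t), (A `&` B); split; first exact: borel_setI.
    exact: strip0I.
  - apply: eq_measurable_fun (pstrip n%:R (Un n) (mUn n)) => p _.
    by rewrite setTI.
  - move=> _ [t [A [mA ->]]].
    apply: eq_measurable_fun (pstrip (Num.min t n%:R) _ (borel_setI mA (mUn n))) => p _.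
    by rewrite /Q -strip0I -setIA.
  - move=> E mE pE.
    apply: eq_measurable_fun (emeasurable_funB (pstrip n%:R (Un n) (mUn n)) pE) => p _.
    have := Wfin p E mE; rewrite -/(Q n) (setIC E) (setIC (~` E)) => fin.
    rewrite (measure_cut (m p.1) (mW p) mE) [X in (X - _)%E]addeC addeK//.
    by rewrite ge0_fin_numE.
  - move=> H mH tH pH.
    apply: (@emeasurable_fun_cvg _ _ _ _ (fun k (p : PT) =>
      (\sum_(0 <= i < k) m p.1 (H i `&` (Q n `&` strip0 (sval p.2) setT)))%E)).
      by move=> k; apply: emeasurable_sum => i; exact: pH.
    move=> p _; rewrite setI_bigcupl.
    apply: measure_semi_sigma_additive.
    + by move=> k; exact: measurableI.
    + by apply: trivIset_setIr.
    + by apply: bigcupT_measurable => k; exact: measurableI.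
move=> E mE.
apply: (@emeasurable_fun_cvg _ _ _ _ (fun n (p : PT) =>
  m p.1 (E `&` (Q n `&` strip0 (sval p.2) setT)))).
  by move=> n; exact: key.
move=> p _.
have -> : E `&` strip0 (sval p.2) setT =
    \bigcup_n (E `&` (Q n `&` strip0 (sval p.2) setT)).
  rewrite -setI_bigcupr -setI_bigcupl (_ : \bigcup_n Q n = setT) ?setTI//.
  exact: strips_cover.
apply: nondecreasing_cvg_mu.
- by move=> n; apply: measurableI => //; exact: measurableI.
- by apply: bigcupT_measurable => n; apply: measurableI => //; exact: measurableI.
- move=> i j ij; apply/subsetPset; apply: setIS; apply: setSI.
  exact/subsetPset/strips_nondecreasing.
Qed.

End predictable_measures.

(** * From the predicate [is_measure] to bundled measures, and monotonicity of suprema *)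

Section spacetime_is_measure.
Context {R : realType} {U : ptopologicalType}.

Lemma measure_is_measure (m : {measure set (spacetime R U) -> \bar R}) :
  is_measure m.
Proof.
by split; [exact: measure0|move=> C _; exact: measure_ge0|
  exact: measure_semi_sigma_additive].
Qed.

Lemma is_measure_measure (mu : set (spacetime R U) -> \bar R) :
  is_measure mu -> exists m : {measure set (spacetime R U) -> \bar R},
    forall C, measurable C -> m C = mu C.
Proof.
move=> [mu0 mu_ge0 mu_sa].
(* [is_measure] leaves the values on nonmeasurable sets free, so they are reset to 0 to obtain
   nonnegativity on all sets. *)
pose m' C : \bar R := if pselect (measurable C) then mu C else 0%E.
have m'E C : measurable C -> m' C = mu C by rewrite /m'; case: pselect.
have m'0 : m' set0 = 0%E by rewrite m'E.
have m'_ge0 C : (0 <= m' C)%E by rewrite /m'; case: pselect => [/=|//]; exact: mu_ge0.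
have m'_sa : semi_sigma_additive m'.
  move=> A mA tA mUA; rewrite m'E//.
  rewrite (_ : (fun n => _) = (fun n => \sum_(0 <= i < n) mu (A i))%E).
    exact: mu_sa.
  by apply/funext => n; apply: eq_bigr => i _; rewrite m'E.
pose b := isMeasure.Build _ (spacetime R U) R m' m'0 m'_ge0 m'_sa.
by pose m : {measure set (spacetime R U) -> \bar R} := HB.pack m' b; exists m.
Qed.

Lemma le_measure_sup (mu1 mu2 : nat -> set (spacetime R U) -> \bar R) E :
  (forall n C, measurable C -> (mu1 n C <= mu2 n C)%E) ->
  (measure_sup mu1 E <= measure_sup mu2 E)%E.
Proof.
move=> mu12; apply: ge_ereal_sup => _ [Pi PiE <-].
apply: le_ereal_sup_tmp; eexists; first by exists Pi.
apply: (le_sum_partition PiE) => C mC; apply: ge_ereal_sup => _ [n _ <-].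
by apply: le_ereal_sup_tmp; exists (mu2 n C); [exists n|exact: mu12].
Qed.

Lemma le_grid_sup (mu1 mu2 : nat -> set (spacetime R U) -> \bar R) (t : R)
    (A : set U) : borel_set A ->
  (forall n C, measurable C -> (mu1 n C <= mu2 n C)%E) ->
  (ereal_sup [set (\sum_(C <- Pi) ereal_sup (range (fun n => mu1 n C)))%E |
     Pi in grid_partition t A] <=
   ereal_sup [set (\sum_(C <- Pi) ereal_sup (range (fun n => mu2 n C)))%E |
     Pi in grid_partition t A])%E.
Proof.
move=> mA mu12; apply: ge_ereal_sup => _ [Pi PiE <-].
apply: le_ereal_sup_tmp; eexists; first by exists Pi.
apply: (le_sum_grid mA PiE) => C mC; apply: ge_ereal_sup => _ [n _ <-].
by apply: le_ereal_sup_tmp; exists (mu2 n C); [exists n|exact: mu12].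
Qed.

End spacetime_is_measure.

(** Normalize a countable dense set, sending 0 to [x0]. If [v] is near a unit vector [u],
    normalizing moves it by the distance of its norm from 1, which is at most its distance to
    [u]. *)
Lemma separable_dense_in_sphere (R : realType) (V : normedModType R) (x0 : V) :
  separable V -> `|x0| = 1 -> exists xn : nat -> V, dense_in_sphere xn.
Proof.
move=> [D /countable_injP[f] inj_f dD] x01.
pose y k := xget 0 [set v | D v /\ f v = k].
have yf v : D v -> y (f v) = v.
  move=> Dv; rewrite /y; case: xgetP => [u _ [Du fuv]|/(_ v)[]//].
  by apply: inj_f; rewrite ?inE.
exists (fun k => if y k == 0 then x0 else `|y k|^-1 *: y k); split => [k|u /= u1].
  case: eqVneq => // yk0.
  by rewrite normrZ normfV normr_id mulVf// normr_eq0.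
move=> B /nbhs_ballP[e /= e0 eB].
(* The bound [1 / 2] keeps [v] away from 0, and [e / 2] leaves room for two errors. *)
pose r := Num.min (e / 2) (1 / 2).
have r0 : 0 < r by rewrite lt_min !divr_gt0.
have [v [uv Dv]] := dD (ball u r) (ex_intro _ u (ballxx u r0)) (ball_open u r).
move: uv; rewrite -ball_normE /= => uv.
have v0 : v != 0.
  apply/negP => /eqP v0; move: uv; rewrite v0 subr0 u1 lt_min => /andP[_].
  by rewrite ltr_pdivlMr// mul1r ltrn1.
exists (`|v|^-1 *: v); split; first by exists (f v) => //; rewrite yf// (negbTE v0).
apply: eB; rewrite -ball_normE /=.
have nv : `|v| != 0 by rewrite normr_eq0.
rewrite (_ : u - _ = (u - v) + (v - `|v|^-1 *: v)); last by rewrite addrA subrK.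
rewrite (le_lt_trans (ler_normD _ _))//.
have -> : `|v - `|v|^-1 *: v| = `| `|v| - 1|.
  rewrite -{1}(scale1r v) -scalerBl normrZ -{2}(normr_id v) -normrM.
  by rewrite mulrBl mul1r mulVf.
apply: (@lt_le_trans _ _ (r + r)); last first.
  by rewrite -mulr2n -mulr_natr -ler_pdivlMr// ge_min lexx.
apply: ltr_leD => //; rewrite -u1; apply: (le_trans (ler_dist_dist _ _)).
by rewrite distrC ltW.
Qed.

(** * The least dominating random measure *)

Section intensities.
Context {R : realType} d (T : measurableType d) (P : probability T R).
Context (F : R -> set (set T)) (U : ptopologicalType) (calA : set (set U)).
Context (X : normedModType R) (M : R -> set U -> dual X -> T -> R).
Context (nu : dual X -> T -> set (spacetime R U) -> \bar R).
Hypotheses (uF : usual_filtration P F) (mvM : orthogonal_mvm P F calA M).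
Hypothesis nuM : forall x, is_intensity P F calA M x (nu x).

(** Read off at time 1 and functional 0; this one sequence is then used for all functionals. *)
Lemma exhausting_sequence : exists Un : nat -> set U,
  [/\ forall n, borel_set (Un n), nondecreasing_seq Un, \bigcup_n Un n = setT &
      forall n A, borel_set A -> A `<=` Un n -> calA A].
Proof.
case: mvM => _ _ _ /(_ 1 0 ltr01)[_ _ [Un [[mUn Und UT] UA _ _ _]]] _.
by exists Un.
Qed.

Variable Un : nat -> set U.
Hypotheses (mUn : forall n, borel_set (Un n)) (Und : nondecreasing_seq Un)
  (UT : \bigcup_n Un n = setT)
  (UA : forall n A, borel_set A -> A `<=` Un n -> calA A).

Definition regular_measure (mu : set (spacetime R U) -> \bar R) :=
  [/\ is_measure mu, forall n, (mu (strip0 n%:R (Un n)) < +oo)%E &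
      mu (strip0 0 setT) = 0%E].

(** On strips over [Un n] the intensity equals a covariation process, which is real-valued and null
    at 0. Countably many null sets are discarded, and null mass at time 0 passes to the union of the
    [Un n]. *)
Lemma ae_regular_intensity x : {ae P, forall w, regular_measure (nu x w)}.
Proof.
have [[_ _ aem] _ _ nuV] := nuM x.
have cUn n : calA (Un n) by exact: (UA (n := n)).
have aefin : {ae P, forall w, forall n, (nu x w (strip0 n%:R (Un n)) < +oo)%E}.
  apply: ae_foralln => n; have [V _ /(_ n%:R (ler0n _ _))] := nuV _ (cUn n).
  by apply: filterS => w ->; rewrite ltry.
have ae0 : {ae P, forall w, forall n, nu x w (strip0 0 (Un n)) = 0%E}.
  apply: ae_foralln => n; have [V [_ V0 _ _] /(_ 0 (lexx _))] := nuV _ (cUn n).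
  by apply: filterS2 V0 => w -> ->.
apply: filterS3 aem aefin ae0 => w mw finw nu0w; split => //.
have [m mE] := is_measure_measure mw.
have mst n : measurable (strip0 0 (Un n) : set (spacetime R U)).
  exact: measurable_strip0.
have -> : strip0 0 setT = \bigcup_n strip0 0 (Un n) :> set (spacetime R U).
  apply/seteqP; split => [p [p0 _]|p [n _ [p0 _]]]; last by split.
  have [n _ Up] : (\bigcup_n Un n) p.2 by rewrite UT.
  by exists n.
rewrite -mE; last exact: bigcupT_measurable.
apply: measure_negligible; first exact: bigcupT_measurable.
by apply: negligible_bigcup => n; apply/negligibleP => //; exact: etrans (mE _ (mst n)) _.
Qed.

Variable xn : nat -> dual X.

(* Replacing [nu (xn n)] by [0] on an exceptional set, which lies in [F 0], makes
   all regularity properties hold surely without losing predictability. *)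
Lemma regular_intensity_versions :
  exists (G : set T) (m : nat -> T -> {measure set (spacetime R U) -> \bar R}),
    [/\ {ae P, forall w, G w},
        forall n w C, G w -> measurable C -> m n w C = nu (xn n) w C,
        forall n C, measurable C -> measurable_fun setT (fun w => m n w C),
        forall n, predictable_measure F (fun w => m n w : set _ -> \bar R) &
        forall n w, regular_measure (m n w)].
Proof.
have [FT _ _ F0] := uF.
pose G : set T := [set w | forall n, regular_measure (nu (xn n) w)].
have aeG : {ae P, forall w, G w}.
  by apply: ae_foralln => n; exact: ae_regular_intensity.
have FG : F 0 (~` G) by exact: F0.
have mG : measurable G.
  by rewrite -(setCK G); apply: measurableC; apply: (FT 0 _).2.
have /choice[m mE] : forall nw : nat * T,
    exists m : {measure set (spacetime R U) -> \bar R},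
      forall C, measurable C -> m C = if nw.2 \in G then nu (xn nw.1) nw.2 C else 0%E.
  move=> [n w] /=; have [Gw|_] := boolP (w \in G); last by exists mzero.
  have [/is_measure_measure[m mE] _ _] := set_mem Gw n.
  by exists m.
exists G, (fun n w => m (n, w)); split => //.
- by move=> n w C /mem_set Gw mC; rewrite mE//= Gw.
- move=> n C mC; rewrite (_ : (fun w => _) =
      fun w => if w \in G then nu (xn n) w C else 0%E); last first.
    by apply/funext => w; rewrite mE.
  apply: measurable_fun_ifT.
  + by apply: (measurable_fun_bool true); rewrite setTI (_ : _ @^-1` _ = G)//;
      apply/seteqP; split => w /=; [move/set_mem|move/mem_set].
  + by case: (nuM (xn n)) => [[_ nuC _] _ _ _]; exact: nuC.
  + exact: measurable_cst.
- move=> n B mB; rewrite /predictable (_ : (fun p => _) = fun p =>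
      if p.1 \in G then nu (xn n) p.1 (strip0 (sval p.2) B) else 0%E); last first.
    by apply/funext => p; rewrite mE//; exact: measurable_strip0.
  apply: measurable_fun_ifT.
  + apply: (measurable_fun_bool true); rewrite setTI.
    rewrite (_ : _ @^-1` _ = ~` (~` G `*` [set: Rplus R])).
      by apply: measurableC; exact: (predictable_cylinder FG).
    apply/seteqP; split => -[w r] /=; first by move/set_mem => Gw [].
    move=> nGw; apply/mem_set; apply: contrapT => Gw; exact: nGw.
  + by case: (nuM (xn n)) => [_ nuB _ _]; exact: nuB.
  + exact: measurable_cst.
- move=> n w; split; first exact: measure_is_measure.
  + move=> k; rewrite mE /=; last exact: measurable_strip0.
    by have [Gw|//] := boolP (w \in G); have [] := set_mem Gw n.
  + rewrite mE /=; last by apply: measurable_strip0; exact: (@measurableT _ (borel U)).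
    by have [Gw|//] := boolP (w \in G); have [] := set_mem Gw n.
Qed.

End intensities.

(** * The quadratic variation attached to one dense sequence *)

Section quadratic_variations.
Context {R : realType} d (T : measurableType d) (P : probability T R).
Context (F : R -> set (set T)) (U : ptopologicalType) (calA : set (set U)).
Context (X : normedModType R) (M : R -> set U -> dual X -> T -> R).
Context (nu : dual X -> T -> set (spacetime R U) -> \bar R).

Lemma ae_forall_countable (J : countType) (Q : J -> T -> Prop) :
  (forall j, {ae P, forall w, Q j w}) -> {ae P, forall w, forall j, Q j w}.
Proof.
move=> aeQ.
have : {ae P, forall w, forall n, if @unpickle J n is Some j then Q j w else True}.
  apply: ae_foralln => n; case: unpickle => [j|]; first exact: aeQ.
  exact: filterE.
by apply: filterS => w Qw j; have := Qw (pickle j); rewrite pickleK.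
Qed.

(** A least element lies below any minimal one, and minimality gives the reverse inequality. *)
Lemma quadratic_variation_least_unique
    (eta eta' : T -> set (spacetime R U) -> \bar R) :
  dominates_intensities P nu eta ->
  (forall zeta, dominates_intensities P nu zeta -> rm_le P eta zeta) ->
  quadratic_variation P calA nu eta' -> rm_eq P eta' eta.
Proof.
move=> eta_dom eta_least [_ eta'_dom eta'_min].
have ee' := eta_least _ eta'_dom; have e'e := eta'_min _ eta_dom ee'.
by apply: filterS2 ee' e'e => w le1 le2 C mC; apply/eqP; rewrite eq_le le1// le2.
Qed.

Hypotheses (uF : usual_filtration P F) (mvM : orthogonal_mvm P F calA M).
Hypothesis nuM : forall x, is_intensity P F calA M x (nu x).
Hypothesis calA_borel : calA `<=` @borel_set U.
Hypothesis sb : sequential_boundedness P calA nu.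
Hypothesis exqv : exists eta, quadratic_variation P calA nu eta.
Variables (f : U -> R) (g : R -> U).
Hypotheses (cf : continuous f) (fK : cancel f g)
  (cg : {within range f, continuous g}).

(** The exceptional set in [sequential_boundedness] depends on the end time; restricting to rational
    end times leaves a countable union of null sets. *)
Lemma ae_sequential_boundedness xn x : dense_in_sphere xn -> `|x| = 1 ->
  {ae P, forall w, forall (q : rat) s A, 0 <= s -> s < ratr q -> calA A ->
    (nu x w (strip s (ratr q) A) <=
     ereal_sup (range (fun n => nu (xn n) w (strip s (ratr q) A))))%E}.
Proof.
move=> xnd x1; apply: ae_forall_countable => q.
have [q0|q0] := ltP 0 (ratr q : R); last first.
  apply: aeW => w s A s0 sq.
  by have := le_lt_trans s0 (lt_le_trans sq q0); rewrite ltxx.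
have [W [mW W1 Wsb]] := sb xnd x1 q0.
exists (~` W); split; first exact: measurableC.
  by rewrite probability_setC// W1 subee.
by apply: subsetC => w Ww s A s0 sq AA; exact: Wsb.
Qed.

Lemma least_quadratic_variation xn : dense_in_sphere xn ->
  exists eta : T -> set (spacetime R U) -> \bar R,
    [/\ quadratic_variation P calA nu eta,
        forall zeta, dominates_intensities P nu zeta -> rm_le P eta zeta,
        predictable_measure F eta,
        rm_eq P eta (fun w => measure_sup (fun n => nu (xn n) w)) &
        {ae P, forall w, forall (t : R) (A : set U), 0 <= t -> borel_set A ->
          eta w (strip0 t A) =
          ereal_sup [set (\sum_(C <- Pi)
                            ereal_sup (range (fun n => nu (xn n) w C)))%E |
                     Pi in grid_partition t A]}].
Proof.
move=> xnd; have [xn1 _] := xnd.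
have [Un [mUn Und UT UA]] := exhausting_sequence mvM.
have [G [m [aeG mE mm mpred mreg]]] :=
  regular_intensity_versions uF nuM mUn UT UA xn.
have mcut := measurable_cut_spacetime cf.
have gcut := measurable_spacetime_cuts fK cg.
(* The regular versions make [eta w] a measure for every [w]. *)
pose eta w := cut_measure (cut f) (m ^~ w).
have etaM w := cut_measure_measure gcut (m ^~ w).
have mU : borel_set [set: U] by exact: (@measurableT _ (borel U)).
have rm_eta : random_measure P eta.
  split.
  - by move=> w C _; exact: cut_measure_ge0.
  - move=> C mC.
    have := @measurable_cut_measure R _ _ _ T _ (cut f) m (fun=> setT) mcut
      (fun=> measurableT) _ C mC.
    rewrite setIT; apply => n E mE'; rewrite setIT; exact: mm.
  - by apply: aeW => w; have [mu muE] := etaM w; rewrite /eta -muE;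
      exact: measure_is_measure.
have eta_least zeta : dominates_intensities P nu zeta -> rm_le P eta zeta.
  move=> [[_ _ zetaM] nuzeta].
  have aele := ae_foralln (fun n => nuzeta _ (xn1 n)).
  apply: filterS3 aeG zetaM aele => w Gw /is_measure_measure[mu muE] le_zeta C mC.
  rewrite -muE//; apply: cut_measure_le => // n A mA.
  by rewrite muE// mE// le_zeta.
have eta_fin t A : 0 <= t -> calA A ->
    {ae P, forall w, (eta w (strip0 t A) < +oo)%E}.
  (* Finiteness comes from the assumed quadratic variation [eta0], which dominates the intensities
     and hence lies above [eta]. *)
  move=> t0 AA; have [eta0 [eta0_fin eta0_dom _]] := exqv.
  apply: filterS2 (eta_least _ eta0_dom) (eta0_fin t A t0 AA) => w le0 fin0.
  apply: le_lt_trans fin0; apply: le0; apply: measurable_strip0.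
  exact: calA_borel.
have eta_dom : dominates_intensities P nu eta.
  split => // x x1.
  have aefin : {ae P, forall w, forall n, (eta w (strip0 n%:R (Un n)) < +oo)%E}.
    by apply: ae_foralln => n; apply: eta_fin => //; exact: (UA n).
  have aex := ae_regular_intensity nuM mUn UT UA x.
  apply: filterS3 (filterI aeG aefin) aex (ae_sequential_boundedness xnd x1) =>
    w [Gw finw] [/is_measure_measure[nux nuxE] _ nux0] sbw C mC.
  have [mu muE] := etaM w.
  rewrite -nuxE// /eta -muE.
  apply: (le_measure_strips cf fK cg mUn Und UT) => //.
  - by move=> n; rewrite muE; exact: finw.
  - by rewrite nuxE//; exact: measurable_strip0.
  (* On strips with rational right end, sequential boundedness puts [nu x] below the supremum of the
     [nu (xn k)], each of which is below [eta]. *)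
  - move=> s q n A s0 sq mA AU; have mS := measurable_strip s (ratr q) mA.
    rewrite nuxE//; apply: (le_trans (sbw q s A s0 sq (UA n A mA AU))).
    apply: ge_ereal_sup => _ [k _ <-]; rewrite muE -mE//.
    exact: (sup_le_cut_measure _ (m ^~ w)).
exists eta; split => //.
- by split => // zeta zeta_dom _; exact: eta_least.
- move=> B mB; pose E : set (spacetime R U) := [set p | B p.2].
  have mE' : measurable E.
    rewrite (_ : E = [set: Rplus R] `*` (B : set (borel U))).
      by apply: measurableX.
    by apply/seteqP; split => p //= [].
  have := @measurable_cut_measure R _ (spacetime R U) _
    (g_sigma_algebraType (predictable_rect F)) _ (cut f) (fun n p => m n p.1)
    (fun p => strip0 (sval p.2) setT) mcut
    (fun p => measurable_strip0 _ mU) _ E mE'.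
  move=> /(_ _)H; rewrite /predictable.
  (* The strip is the time-independent cylinder [E] seen through the moving window up to [t], as in
     [measurable_cut_measure]. *)
  have EB t : strip0 t B = E `&` strip0 t setT.
    by apply/seteqP; split => [x [xt Bx]|x [Bx [xt _]]].
  have -> : (fun p : T * Rplus R => eta p.1 (strip0 (sval p.2) B)) =
      fun p => cut_measure (cut f) (fun n => m n p.1)
        (E `&` strip0 (sval p.2) setT).
    by apply/funext => p; rewrite EB.
  apply: H => n A mA.
  apply: (predictable_strip_measure mUn Und UT) => //.
  by move=> w k; case: (mreg n w).
- apply: filterS aeG => w Gw C mC; rewrite /eta (cut_measure_supE cf fK cg)//.
  by apply/eqP; rewrite eq_le; apply/andP; split; apply: le_measure_sup => n A mA;
    rewrite mE.
- apply: filterS aeG => w Gw t A t0 mA; rewrite /eta (cut_measure_gridE cf fK cg)//.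
    by apply/eqP; rewrite eq_le; apply/andP; split; apply: le_grid_sup => // n C mC;
      rewrite mE.
  by move=> n; case: (mreg n w).
Qed.

End quadratic_variations.

(** * Uniqueness and independence of the dense sequence *)

Theorem theorem5p10 (R : realType) (d : measure_display) (T : measurableType d)
  (P : probability T R) (F : R -> set (set T))
  (U : ptopologicalType) (calA : set (set U))
  (X : completeNormedModType R)
  (M : R -> set U -> dual X -> T -> R)
  (nu : dual X -> T -> set (spacetime R U) -> \bar R) :
  measure_is_complete P ->
  usual_filtration P F ->
  hausdorff_space U ->
  homeomorphic_to_borel_of_R R U ->
  setring calA ->
  calA `<=` @borel_set U ->
  separable (dual X) ->
  orthogonal_mvm P F calA M ->
  (forall x, is_intensity P F calA M x (nu x)) ->
  (exists eta, quadratic_variation P calA nu eta) ->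
  sequential_boundedness P calA nu ->
  exists eta : T -> set (spacetime R U) -> \bar R,
    [/\ quadratic_variation P calA nu eta,
        forall eta', quadratic_variation P calA nu eta' -> rm_eq P eta' eta,
        predictable_measure F eta &
        forall xn : nat -> dual X, dense_in_sphere xn ->
          rm_eq P eta (fun w => measure_sup (fun n => nu (xn n) w)) /\
          {ae P, forall w, forall (t : R) (A : set U), 0 <= t -> borel_set A ->
            eta w (strip0 t A) =
            ereal_sup [set (\sum_(C <- Pi)
                              ereal_sup (range (fun n => nu (xn n) w C)))%E |
                       Pi in grid_partition t A]}].
Proof.
move=> _ uF _ [f [g [_ cf fK cg]]] _ calA_borel sepX mvM nuM exqv sb.
(* Without unit functionals every random measure dominates, so the zero measure is the least one,
   and no dense sequence of the sphere exists. *)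
have [[x x1]|nosphere] := pselect (exists x : dual X, `|x| = 1); last first.
  pose eta0 (_ : T) (_ : set (spacetime R U)) : \bar R := 0%E.
  have dom0 : dominates_intensities P nu eta0.
    split; last by move=> x x1; case: nosphere; exists x.
    split => //; apply: aeW => w.
    exact: (measure_is_measure (@mzero _ _ R)).
  have least0 zeta : dominates_intensities P nu zeta -> rm_le P eta0 zeta.
    by move=> [[zeta0 _ _] _]; apply: aeW => w; exact: zeta0.
  exists eta0; split.
  - split => [t A _ _| |zeta + _] //; last exact: least0.
    by apply: aeW => w; exact: ltry.
  - by move=> eta'; exact: quadratic_variation_least_unique.
  - by move=> B _; exact: measurable_cst.
  - by move=> xn [xn1 _]; case: nosphere; exists (xn 0%N).
have [x0 x0d] := separable_dense_in_sphere sepX x1.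
have [eta [etaQ eta_least eta_pred _ _]] :=
  least_quadratic_variation uF mvM nuM calA_borel sb exqv cf fK cg x0d.
have [_ eta_dom _] := etaQ.
have eta_uniq eta' : quadratic_variation P calA nu eta' -> rm_eq P eta' eta.
  exact: quadratic_variation_least_unique.
exists eta; split => // xn xnd.
(* Another dense sequence gives a quadratic variation [etax] with its own formulas; uniqueness
   identifies it with [eta] and transfers them. *)
have [etax [etaxQ _ _ etaxE etax_grid]] :=
  least_quadratic_variation uF mvM nuM calA_borel sb exqv cf fK cg xnd.
have etaE := eta_uniq _ etaxQ; split.
  by apply: filterS2 etaE etaxE => w e1 e2 C mC; rewrite -e1// e2.
apply: filterS2 etaE etax_grid => w e1 e2 t A t0 mA.
by rewrite -e1 ?e2//; exact: measurable_strip0.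
Qed.
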